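(* The map $\operatorname{Envd}\colon p\mathrm{Sch}\to\mathrm{Sch}$, which sends $\mathfrak{K}$ to the class $\operatorname{Envd}(\mathfrak{K})$ of all Lie algebras having a $p$-envelope in $\mathfrak{K}$, is a lattice homomorphism, and it sends $p$-formations to formations.
   Context: All Lie algebras are finite-dimensional over a fixed field $F$ of characteristic $p\neq 0$. A restricted Lie algebra $(L,[p])$ is a Lie algebra $L$ with a $p$-operation $x\mapsto x^{[p]}$ in the usual sense; it is soluble if the Lie algebra $L$ is. A $[p]$-subalgebra is a subalgebra $U$ with $U^{[p]}\subseteq U$; a $[p]$-ideal is an ideal which is a $[p]$-subalgebra; for a $[p]$-ideal $K$, $L/K$ carries the induced $p$-operation. Classes of (restricted) Lie algebras are closed under isomorphism. Ordinary soluble Lie algebras: $L$ is primitive if it has a minimal (nonzero) ideal $A$ with centraliser $\mathcal{C}_L(A)=A$. $\mathrm{P}\mathfrak{X}$ denotes the class of all soluble Lie algebras all of whose primitive quotients are in $\mathfrak{X}$; a Schunck class is a non-empty class $\mathfrak{X}$ of soluble Lie algebras with $\mathrm{P}\mathfrak{X}=\mathfrak{X}$. A formation is a non-empty class of soluble Lie algebras closed under quotients and such that $L\in\mathfrak{X}$ whenever $L$ has ideals $K_i$ with $\bigcap_i K_i=0$ and all $L/K_i\in\mathfrak{X}$. $\mathrm{Sch}$ is the collection of all nonzero Schunck classes (those containing some nonzero algebra), ordered by inclusion. Soluble restricted Lie algebras: $(L,[p])$ is primitive if it has a minimal (nonzero) $[p]$-ideal $A$ with $\mathcal{C}_L(A)=A$.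 $\mathrm{P}\mathfrak{X}$ denotes the class of all soluble restricted Lie algebras all of whose primitive quotients (by $[p]$-ideals) are in $\mathfrak{X}$; a $p$-Schunck class is a non-empty class $\mathfrak{X}$ with $\mathrm{P}\mathfrak{X}=\mathfrak{X}$. A $p$-formation is a non-empty class of soluble restricted Lie algebras closed under quotients by $[p]$-ideals and such that $(L,[p])\in\mathfrak{X}$ whenever $L$ has $[p]$-ideals $K_i$ with $\bigcap_i K_i=0$ and all $L/K_i\in\mathfrak{X}$. An atom is a nonzero soluble restricted Lie algebra whose only $[p]$-subalgebras are $0$ and itself. $p\mathrm{Sch}$ is the collection of all $p$-Schunck classes containing all atoms, ordered by inclusion. In both $\mathrm{Sch}$ and $p\mathrm{Sch}$ the meet of $\mathfrak{H}_1,\mathfrak{H}_2$ is $\mathfrak{H}_1\cap\mathfrak{H}_2$ and the join is $\mathfrak{H}_1+\mathfrak{H}_2=\mathrm{P}(\operatorname{Skel}(\mathfrak{H}_1)\cup\operatorname{Skel}(\mathfrak{H}_2))$, where $\operatorname{Skel}(\mathfrak{H})$ is the class of all primitive algebras in $\mathfrak{H}$. A $p$-envelope of a Lie algebra $U$ is a (finite-dimensional) restricted Lie algebra $(L,[p])$ together with an injective Lie algebra homomorphism $i\colon U\to L$ such that the smallest $[p]$-subalgebra of $L$ containing $i(U)$ is $L$. *)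

(* Defs.v *)
From HB Require Import structures.
From mathcomp Require Import all_boot all_order all_algebra.

Set Implicit Arguments.
Unset Strict Implicit.
Unset Printing Implicit Defensive.

Import GRing.Theory.
Local Open Scope ring_scope.

HB.mixin Record Vector_isLieAlgebra (F : fieldType) L of Vector F L := {
  lie : L -> L -> L;
  lie_linearr : forall x, linear (lie x);
  lie_linearl : forall y, linear (lie^~ y);
  liexx : forall x, lie x x = 0;
  lie_jacobi : forall x y z,
    lie x (lie y z) + lie y (lie z x) + lie z (lie x y) = 0
}.

#[short(type="lieAlgType")]
HB.structure Definition LieAlgebra (F : fieldType) :=
  { L of Vector_isLieAlgebra F L & Vector F L }.

(* [lie_coef x y n j] is the coefficient of T^j in (ad (T x + y))^n (x),
   computed in L[T]. *)
Fixpoint lie_coef (F : fieldType) (L : lieAlgType F) (x y : L) (n j : nat) : L :=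
  match n with
  | 0 => if j is 0 then x else 0
  | m.+1 => lie y (lie_coef x y m j) +
            (if j is k.+1 then lie x (lie_coef x y m k) else 0)
  end.

(* Jacobson's Lie polynomials s_i, given by
     (ad (T x + y))^(p-1) (x) = \sum_(1 <= i < p) i * s_i(x, y) * T^(i-1). *)
Definition jacobson_s (F : fieldType) (L : lieAlgType F) (p : nat) (x y : L)
    (i : nat) : L :=
  i%:R^-1 *: lie_coef x y p.-1 i.-1.

HB.mixin Record LieAlgebra_isRestricted (p : nat) (F : fieldType) L
    of LieAlgebra F L := {
  pmap : L -> L;
  lie_pmapl : forall x y, lie (pmap x) y = iter p (lie x) y;
  pmapZ : forall (a : F) x, pmap (a *: x) = a ^+ p *: pmap x;
  pmapD : forall x y, pmap (x + y) =
    pmap x + pmap y + \sum_(1 <= i < p) jacobson_s p x y i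
}.

#[short(type="resLieAlgType")]
HB.structure Definition RestrictedLieAlgebra (p : nat) (F : fieldType) :=
  { L of LieAlgebra_isRestricted p F L & LieAlgebra F L }.

Section LieAlgebraNotions.
Variables (F : fieldType) (L : lieAlgType F).
Implicit Types (U V K A B : {vspace L}) (x y : L).

Lemma lieDr x y z : lie x (y + z) = lie x y + lie x z.
Proof. by have := lie_linearr x 1 y z; rewrite !scale1r. Qed.

Lemma lieDl x y z : lie (x + y) z = lie x z + lie y z.
Proof. by have := lie_linearl z 1 x y; rewrite !scale1r. Qed.

Lemma lie0r x : lie x 0 = 0.
Proof. by apply: (addIr (lie x 0)); rewrite -lieDr !add0r. Qed.

Lemma lie0l y : lie 0 y = 0.
Proof. by apply: (addIr (lie 0 y)); rewrite -lieDl !add0r. Qed.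

Lemma lieZr x a y : lie x (a *: y) = a *: lie x y.
Proof. by have := lie_linearr x a y 0; rewrite !addr0 lie0r addr0. Qed.

Lemma lieZl a x y : lie (a *: x) y = a *: lie x y.
Proof. by have := lie_linearl y a x 0; rewrite !addr0 lie0l addr0. Qed.

Lemma lie_antisym x y : lie x y = - lie y x.
Proof.
have := liexx (x + y); rewrite lieDr !lieDl !liexx add0r addr0 => /eqP.
by rewrite addr_eq0 => /eqP ->; rewrite opprK.
Qed.

Definition subalgebra U := forall x y, x \in U -> y \in U -> lie x y \in U.

Definition ideal K := forall x y, y \in K -> lie x y \in K.

Lemma ideal_liel K x y : ideal K -> x \in K -> lie x y \in K.
Proof. by move=> idK Kx; rewrite lie_antisym rpredN idK. Qed.

Definition centraliser A : L -> Prop := fun x => forall a, a \in A -> lie x a = 0.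

Definition minimal_ideal A :=
  [/\ ideal A, A != 0%VS
    & forall B, ideal B -> (B <= A)%VS -> B = 0%VS \/ B = A].

Definition primitive := exists A,
  minimal_ideal A /\ (forall x, centraliser A x <-> x \in A).

Definition lie_prod U V : {vspace L} :=
  <<[seq lie u v | u <- vbasis U, v <- vbasis V]>>%VS.

Fixpoint derived (n : nat) : {vspace L} :=
  if n is m.+1 then lie_prod (derived m) (derived m) else fullv.

Definition soluble := exists n, derived n = 0%VS.

Lemma lie_prod_subP U V B :
  (forall u v, u \in U -> v \in V -> lie u v \in B) <-> (lie_prod U V <= B)%VS.
Proof.
split=> [UVB | /subvP sUVB u v Uu Vv].
  apply/span_subvP => _ /allpairsP[[u v] /= [Uu Vv ->]].
  by apply: UVB; apply: vbasis_mem.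
apply: sUVB; move: Uu Vv => /coord_vbasis-> /coord_vbasis->.
set W := lie_prod U V; set s := (X in lie _ X).
apply: (big_ind (fun z => lie z s \in W)) => [|y z Wy Wz|i _].
- by rewrite lie0l mem0v.
- by rewrite lieDl memvD.
rewrite lieZl memvZ // {}/s.
apply: (big_ind (fun z => lie _ z \in W)) => [|y z Wy Wz|j _].
- by rewrite lie0r mem0v.
- by rewrite lieDr memvD.
rewrite lieZr memvZ // memv_span //; apply/allpairsP.
by exists ((vbasis U)`_i, (vbasis V)`_j); rewrite !mem_nth ?size_tuple.
Qed.

End LieAlgebraNotions.

Arguments primitive {F} L.
Arguments derived {F} L n.
Arguments soluble {F} L.

Section RestrictedNotions.
Variables (p : nat) (F : fieldType) (L : resLieAlgType p F).
Implicit Types (U K A B : {vspace L}).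

Definition p_closed U := forall x : L, x \in U -> pmap x \in U.

Definition p_subalgebra U := subalgebra U /\ p_closed U.

Definition p_ideal K := ideal K /\ p_closed K.

Definition minimal_p_ideal A :=
  [/\ p_ideal A, A != 0%VS
    & forall B, p_ideal B -> (B <= A)%VS -> B = 0%VS \/ B = A].

Definition p_primitive := exists A,
  minimal_p_ideal A /\ (forall x, centraliser A x <-> x \in A).

Definition atom :=
  [/\ soluble L, {:L}%VS != 0%VS
    & forall U, p_subalgebra U -> U = 0%VS \/ U = fullv].

End RestrictedNotions.

Arguments p_primitive {p F} L.
Arguments atom {p F} L.

Section Morphisms.
Variable F : fieldType.

Definition lie_morphism (L M : lieAlgType F) (f : 'Hom(L, M)) :=
  forall x y, f (lie x y) = lie (f x) (f y).

Definition lie_iso (L M : lieAlgType F) := exists f : 'Hom(L, M),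
  lie_morphism f /\ bijective f.

Definition res_lie_iso (p : nat) (L M : resLieAlgType p F) :=
  exists f : 'Hom(L, M),
    [/\ lie_morphism f, forall x, f (pmap x) = pmap (f x) & bijective f].

End Morphisms.

(* The quotient L/K is realised on the complement K^C of K: each coset of K has
   a unique representative in K^C, and [quot_proj K] sends x to the
   representative of x + K. *)
Section QuotientProjection.
Variables (F : fieldType) (L : lieAlgType F) (K : {vspace L}).

Definition quot_proj (x : L) : subvs_of K^C := vsproj K^C (daddv_pi K^C K x).

Lemma quot_proj_linear : linear quot_proj.
Proof. by move=> a x y; rewrite /quot_proj !linearP. Qed.

HB.instance Definition _ := GRing.isSemilinear.Build F L (subvs_of K^C) _
  quot_proj (GRing.semilinear_linear quot_proj_linear).

Let capCK : (K^C :&: K = 0)%VS.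
Proof. by rewrite capvC capv_compl. Qed.

Lemma quot_projK : cancel vsval quot_proj.
Proof. by move=> u; rewrite /quot_proj daddv_pi_id ?subvsP // vsvalK. Qed.

Lemma quot_projB (x : L) : x - vsval (quot_proj x) \in K.
Proof.
rewrite /quot_proj vsprojK ?memv_pi //.
have /(daddv_pi_add capCK) : x \in (K^C + K)%VS.
  by rewrite addvC addv_complf memvf.
by move/(canRL (addKr _)); rewrite addrC => <-; apply: memv_pi.
Qed.

Lemma quot_proj_eq0 (x : L) : (quot_proj x == 0) = (x \in K).
Proof.
apply/eqP/idP => [x0 | Kx].
  by have := quot_projB x; rewrite x0 (linear0 vsval) subr0.
have Kv : vsval (quot_proj x) \in K.
  by have := rpredB Kx (quot_projB x); rewrite opprB addrC subrK.
have : vsval (quot_proj x) \in (K^C :&: K)%VS by rewrite memv_cap subvsP Kv.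
by rewrite capCK memv0 => /eqP v0; apply: val_inj; rewrite /= v0.
Qed.

Lemma quot_proj_eq (x y : L) : x - y \in K -> quot_proj x = quot_proj y.
Proof. by rewrite -quot_proj_eq0 linearB subr_eq0 => /eqP. Qed.

Definition quot_lie (u v : subvs_of K^C) := quot_proj (lie (vsval u) (vsval v)).

Lemma quot_proj_lie (x y : L) : ideal K ->
  quot_proj (lie x y) = quot_lie (quot_proj x) (quot_proj y).
Proof.
move=> idK; apply: quot_proj_eq.
set x' := vsval (quot_proj x); set y' := vsval (quot_proj y).
have -> : lie x y - lie x' y' = lie (x - x') y + lie x' (y - y').
  rewrite -!scaleN1r !lieDl !lieDr lieZl lieZr addrA; congr (_ + _).
  by rewrite -addrA !scaleN1r addNr addr0.
apply: memvD; last by apply: idK; apply: quot_projB.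
by apply: ideal_liel => //; apply: quot_projB.
Qed.

End QuotientProjection.

Definition quot (F : fieldType) (L : lieAlgType F) (K : {vspace L})
  of ideal K : Type := subvs_of K^C.

Section Quotient.
Variables (F : fieldType) (L : lieAlgType F) (K : {vspace L}) (idK : ideal K).

HB.instance Definition _ := Vector.copy (quot idK) (subvs_of K^C).

Fact quot_lie_linearr (u : quot idK) : linear (@quot_lie F L K u).
Proof. by move=> a v w; rewrite /quot_lie !linearP lie_linearr linearP. Qed.

Fact quot_lie_linearl (v : quot idK) : linear ((@quot_lie F L K)^~ v).
Proof. by move=> a u w; rewrite /quot_lie !linearP lie_linearl linearP. Qed.

Fact quot_liexx (u : quot idK) : quot_lie u u = 0.
Proof. by rewrite /quot_lie liexx linear0. Qed.

Fact quot_lie_jacobi (u v w : quot idK) :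
  quot_lie u (quot_lie v w) + quot_lie v (quot_lie w u)
    + quot_lie w (quot_lie u v) = 0.
Proof.
rewrite -[u]quot_projK -[v]quot_projK -[w]quot_projK -!(quot_proj_lie _ _ idK).
by rewrite -!linearD lie_jacobi linear0.
Qed.

HB.instance Definition _ := Vector_isLieAlgebra.Build F (quot idK)
  quot_lie_linearr quot_lie_linearl quot_liexx quot_lie_jacobi.

End Quotient.

Definition p_quot (p : nat) (F : fieldType) (L : resLieAlgType p F)
  (K : {vspace L}) (pidK : p_ideal K) : Type := quot (proj1 pidK).

Section RestrictedQuotient.
Variables (p : nat) (F : fieldType) (L : resLieAlgType p F) (K : {vspace L}).
Variable pidK : p_ideal K.
Local Notation Q := (p_quot pidK).

HB.instance Definition _ := LieAlgebra.copy Q (quot (proj1 pidK)).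

Let pi (x : L) : Q := quot_proj K x.

Let pi_lie x y : pi (lie x y) = lie (pi x) (pi y).
Proof. exact: (quot_proj_lie _ _ (proj1 pidK)). Qed.

Let piD x y : pi (x + y) = pi x + pi y.
Proof. exact: (linearD (quot_proj K)). Qed.

Let piZ a x : pi (a *: x) = a *: pi x.
Proof. exact: (linearZ_LR (quot_proj K)). Qed.

Let pi0 : pi 0 = 0.
Proof. exact: (linear0 (quot_proj K)). Qed.

Let pi_coef x y n j : pi (lie_coef x y n j) = lie_coef (pi x) (pi y) n j.
Proof.
elim: n j => [|n IHn] [|j] //=; first by rewrite !addr0 pi_lie IHn.
by rewrite piD !pi_lie !IHn.
Qed.

Let pi_sum x y :
  pi (\sum_(1 <= i < p) jacobson_s p x y i) =
  \sum_(1 <= i < p) jacobson_s p (pi x) (pi y) i.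
Proof.
rewrite (big_morph pi piD pi0); apply: eq_bigr => i _.
by rewrite /jacobson_s piZ pi_coef.
Qed.

Definition p_quot_pmap (u : Q) : Q := quot_proj K (pmap (vsval u)).

(* Well-definedness of the induced p-operation: this is where K being closed
   under the p-operation is used. *)
Lemma quot_proj_pmap (x : L) :
  p_quot_pmap (quot_proj K x) = quot_proj K (pmap x).
Proof.
have Kd : vsval (quot_proj K x) - x \in K.
  by rewrite -opprB rpredN quot_projB.
rewrite /p_quot_pmap -[vsval _](subrK x) pmapD.
set d := _ - x in Kd *.
have coefK n j : lie_coef d x n j \in K.
  elim: n j => [|n IHn] [|j] //=; rewrite ?mem0v ?addr0 ?(proj1 pidK) //.
  by rewrite memvD // (proj1 pidK).
apply: quot_proj_eq; rewrite addrAC addrK memvD ?(proj2 pidK) //.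
by rewrite memv_suml // => i _; rewrite memvZ.
Qed.

Fact p_quot_lie_pmapl (u v : Q) : lie (p_quot_pmap u) v = iter p (lie u) v.
Proof.
have uE : u = pi (vsval u) by rewrite /pi quot_projK.
have vE : v = pi (vsval v) by rewrite /pi quot_projK.
rewrite /p_quot_pmap -/(pi _) vE -pi_lie lie_pmapl.
set x := vsval u; set y := vsval v.
suff iterE n : pi (iter n (lie x) y) = iter n (lie u) (pi y) by exact: iterE.
by elim: n => //= n IHn; rewrite pi_lie IHn /x -uE.
Qed.

Fact p_quot_pmapZ (a : F) (u : Q) :
  p_quot_pmap (a *: u) = a ^+ p *: p_quot_pmap u.
Proof. by rewrite /p_quot_pmap linearZ /= pmapZ -/(pi _) piZ. Qed.

Fact p_quot_pmapD (u v : Q) : p_quot_pmap (u + v) =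
  p_quot_pmap u + p_quot_pmap v + \sum_(1 <= i < p) jacobson_s p u v i.
Proof.
rewrite /p_quot_pmap linearD /= pmapD -/(pi _) !piD pi_sum.
by rewrite /pi !quot_projK.
Qed.

HB.instance Definition _ := LieAlgebra_isRestricted.Build p F Q
  p_quot_lie_pmapl p_quot_pmapZ p_quot_pmapD.

End RestrictedQuotient.

Section LieClasses.
Variable F : fieldType.

Definition lie_class := lieAlgType F -> Prop.

Implicit Types X H : lie_class.

Definition iso_closed X := forall L M, lie_iso L M -> X L -> X M.

Definition primitive_closure X : lie_class := fun L =>
  soluble L /\
  forall (K : {vspace L}) (idK : ideal K),
    primitive (quot idK) -> X (quot idK).

Definition schunck X :=
  [/\ iso_closed X, exists L, X L, forall L, X L -> soluble L
    & forall L, primitive_closure X L <-> X L].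

Definition formation X :=
  [/\ iso_closed X, exists L, X L, forall L, X L -> soluble L,
      forall (L : lieAlgType F) (K : {vspace L}) (idK : ideal K), X L -> X (quot idK)
    & forall (L : lieAlgType F) (I : Type) (K : I -> {vspace L})
          (idK : forall i, ideal (K i)),
        (forall x, (forall i, x \in K i) -> x = 0) ->
        (forall i, X (quot (idK i))) -> X L].

Definition Sch H := schunck H /\ exists L, H L /\ {:L}%VS != 0%VS.

Definition Skel H : lie_class := fun L => H L /\ primitive L.

Definition Sch_meet H1 H2 : lie_class := fun L => H1 L /\ H2 L.

Definition Sch_join H1 H2 : lie_class :=
  primitive_closure (fun L => Skel H1 L \/ Skel H2 L).

End LieClasses.

Section RestrictedLieClasses.
Variables (p : nat) (F : fieldType).

Definition res_lie_class := resLieAlgType p F -> Prop.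

Implicit Types X H : res_lie_class.

Definition p_iso_closed X := forall L M, res_lie_iso L M -> X L -> X M.

Definition p_primitive_closure X : res_lie_class := fun L =>
  soluble L /\
  forall (K : {vspace L}) (pidK : p_ideal K),
    p_primitive (p_quot pidK) -> X (p_quot pidK).

Definition p_schunck X :=
  [/\ p_iso_closed X, exists L, X L, forall L, X L -> soluble L
    & forall L, p_primitive_closure X L <-> X L].

Definition p_formation X :=
  [/\ p_iso_closed X, exists L, X L, forall L, X L -> soluble L,
      forall (L : resLieAlgType p F) (K : {vspace L}) (pidK : p_ideal K),
        X L -> X (p_quot pidK)
    & forall (L : resLieAlgType p F) (I : Type) (K : I -> {vspace L})
          (pidK : forall i, p_ideal (K i)),
        (forall x, (forall i, x \in K i) -> x = 0) ->
        (forall i, X (p_quot (pidK i))) -> X L].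

Definition pSch H := p_schunck H /\ forall L, atom L -> H L.

Definition p_Skel H : res_lie_class := fun L => H L /\ p_primitive L.

Definition pSch_meet H1 H2 : res_lie_class := fun L => H1 L /\ H2 L.

Definition pSch_join H1 H2 : res_lie_class :=
  p_primitive_closure (fun L => p_Skel H1 L \/ p_Skel H2 L).

Definition p_envelope (U : lieAlgType F) (L : resLieAlgType p F)
    (i : 'Hom(U, L)) :=
  [/\ lie_morphism i, injective i
    & forall V : {vspace L}, p_subalgebra V -> (limg i <= V)%VS -> V = fullv].

Definition Envd X : lie_class F := fun U =>
  exists (L : resLieAlgType p F) (i : 'Hom(U, L)), X L /\ p_envelope i.

End RestrictedLieClasses.

(* Main.v *)
From HB Require Import structures.
From Stdlib Require Import Classical_Prop.
From mathcomp Require Import all_boot all_order all_algebra.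
From mathcomp Require Import zify.
Require Import Defs.

Set Implicit Arguments.
Unset Strict Implicit.
Unset Printing Implicit Defensive.

Import GRing.Theory.
Local Open Scope ring_scope.

(** The argument rests on a dictionary between the ideals of a Lie algebra U
    and those of a p-envelope L of U. A subspace of the form {x | [x, A] <= B}
    with B <= A is a [p]-subalgebra, because (ad x)^p then maps A into B as
    well; as no proper [p]-subalgebra of L contains U, any such condition which
    holds on U holds on all of L ([p_envelope_transporter]). Hence [L, L] <= U,
    every ideal of U is an ideal of L, and the centre of L is the centraliser
    of U.

    Independence of the envelope. If V is a quotient of U, and L and M are
    p-envelopes of U and V, then both L and M act on V by derivations, and the
    two images in End V coincide: each is generated, under brackets and p-th
    powers, by the inner derivations of V. The action of M has the centre Z(M)
    as its kernel, so L maps onto M / Z(M) ([envelope_morphism]). Centres are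
    invisible to a p-Schunck class K containing all atoms: a p-primitive
    algebra is either abelian, and then an atom, or has centre 0; therefore K
    contains L as soon as it contains L / Z(L) ([pSch_central_extension]). So K
    contains all the p-envelopes of U or none of them, and Envd K is closed
    under quotients. The compatibility with meets follows at once.

    Primitive quotients. A non-abelian p-primitive quotient M of L is a
    p-envelope of the image V of U, and V is primitive: the minimal [p]-ideal A
    of M satisfies A = [M, A] <= V ([primitive_of_p_primitive]). Conversely, a
    non-abelian primitive quotient V of U has a p-envelope N with centre 0
    which is a quotient of L, and N is p-primitive ([p_primitive_envelope]).
    Thus the primitive quotients of U and the p-primitive quotients of L
    control each other, which yields the Schunck property and the compatibility
    with joins.

    For formations, ideals J_a of U with intersection 0 give the [p]-ideals {x
    | [x, U] <= J_a} of L, whose intersection is the centre of L; the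
    corresponding quotients of L are M_a / Z(M_a) for envelopes M_a of U / J_a,
    so L / Z(L) belongs to K, and hence so does L.

    All this needs each soluble U to have a p-envelope ([p_envelope_exists]).
    It is enough to represent U faithfully by matrices, since matrices form a
    restricted Lie algebra under a |-> a^p, by Jacobson's formula. The
    representation is built by induction along a chain of subalgebras, each an
    ideal of codimension 1 in the next ([extend_faithful]): if H is such an
    ideal of W = H + F x, the derivation D = ad x satisfies a relation D^(p^m)
    = \sum_i c_i D^(p^i), and the sequences in an H-module which satisfy the
    corresponding linear recurrence form a finite-dimensional W-module. *)

(** * Linear maps and binomial sums *)

HB.instance Definition _ (F : fieldType) (L : lieAlgType F) (x : L) :=
  GRing.isSemilinear.Build F L L _ (lie x)
    (GRing.semilinear_linear (lie_linearr x)).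

(** The bracket with its arguments exchanged, so that bracketing on the right
    is also a canonical linear map. *)
Definition lier (F : fieldType) (L : lieAlgType F) (y x : L) := lie x y.

HB.instance Definition _ (F : fieldType) (L : lieAlgType F) (y : L) :=
  GRing.isSemilinear.Build F L L _ (lier y)
    (GRing.semilinear_linear (lie_linearl y)).

Lemma lieNr (F : fieldType) (L : lieAlgType F) (x y : L) :
  lie x (- y) = - lie x y.
Proof. exact: linearN. Qed.

Lemma lieNl (F : fieldType) (L : lieAlgType F) (x y : L) :
  lie (- x) y = - lie x y.
Proof. exact: (linearN (lier y)). Qed.

Lemma lie_derivation (F : fieldType) (L : lieAlgType F) (x y z : L) :
  lie x (lie y z) = lie (lie x y) z + lie y (lie x z).
Proof.
have := lie_jacobi x y z; rewrite (lie_antisym z x) lieNr (lie_antisym z).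
by move/eqP; rewrite -addrA -opprD subr_eq0 addrC => /eqP.
Qed.

(** Turns a function into a morphism of vector spaces without declaring a
    canonical structure for it, which allows functions built inside proofs. *)
Lemma linfunP (R : nzRingType) (aT rT : vectType R) (f : aT -> rT) :
  linear f -> {g : 'Hom(aT, rT) | g =1 f}.
Proof.
move=> f_lin.
pose M := GRing.isSemilinear.Build R aT rT _ f (GRing.semilinear_linear f_lin).
pose lf : {linear aT -> rT} := HB.pack f M.
by exists (linfun lf) => x; rewrite lfunE.
Qed.

Lemma pascal_sum (V : nmodType) (G : nat -> V) n :
  \sum_(k < n.+1) (G k + G k.+1) *+ 'C(n, k) =
  \sum_(k < n.+2) G k *+ 'C(n.+1, k).
Proof.
rewrite big_ord_recl bin0 /= [RHS]big_ord_recl bin0 /= !mulr1n -addrA.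
congr (_ + _).
under [RHS]eq_bigr do rewrite /bump /= add1n binS mulrnDr.
rewrite big_split /= [in RHS]big_ord_recr /= bin_small // mulr0n addr0.
under eq_bigr do rewrite /bump /= add1n mulrnDl.
rewrite big_split /= addrCA; congr (_ + _).
by rewrite [RHS]big_ord_recl bin0 mulr1n.
Qed.

(** The binomial expansion of (s + t)^n for two commuting operators s and t, in
    the form needed both for iterated commutators (s and t are left and right
    multiplications) and for iterated derivations of a product. *)
Lemma leibniz_rule (V : nmodType) (X : nat -> nat -> nat -> V) :
  (forall k i j, X k.+1 i j = X k i.+1 j + X k i j.+1) ->
  forall n k i j,
  X (n + k)%N i j = \sum_(l < n.+1) X k (i + l)%N (j + (n - l))%N *+ 'C(n, l).
Proof.
move=> XS; elim=> [|n IHn] k i j.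
  by rewrite big_ord1 bin0 mulr1n subn0 !addn0.
rewrite addSn XS !IHn -big_split /=.
rewrite -(pascal_sum (fun l => X k (i + l) (j + (n.+1 - l)))%N).
apply: eq_bigr => -[l ltln] _; rewrite mulrnDl addrC /=.
by congr (X k _ _ *+ _ + X k _ _ *+ _); lia.
Qed.

(** * Jacobson's formula for matrices *)

Section Commutators.
Variables (R : nzRingType) (p : nat) (pcharRp : p \in [pchar R]).

Lemma bin_pred_pchar k : (k < p)%N -> ('C(p.-1, k))%:R = (-1) ^+ k :> R.
Proof.
have p_gt0 : (0 < p)%N := prime_gt0 (pcharf_prime pcharRp).
elim: k => [|k IHk] ltkp; first by rewrite bin0 expr0.
have := bin_lt_pcharf_0 pcharRp (k := k.+1); rewrite ltkp => /(_ isT).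
rewrite -{1}(prednK p_gt0) binS natrD IHk 1?ltnW // => /eqP.
by rewrite addr_eq0 => /eqP ->; rewrite exprS mulN1r.
Qed.

Definition commutator (a b : R) := a * b - b * a.

Lemma iter_commutator (a b : R) n :
  iter n (commutator a) b =
  \sum_(l < n.+1) ((-1) ^+ (n - l) * (a ^+ l * b * a ^+ (n - l))) *+ 'C(n, l).
Proof.
pose X k i j := iter k (commutator a) ((-1) ^+ j * (a ^+ i * b * a ^+ j)).
have commB : {morph commutator a : u v / u + v}.
  by move=> u v; rewrite /commutator mulrDr mulrDl opprD addrACA.
have XS k i j : X k.+1 i j = X k i.+1 j + X k i j.+1.
  rewrite /X; have -> u v : iter k (commutator a) u + iter k (commutator a) v =
    iter k (commutator a) (u + v) by elim: k => //= k <-; rewrite commB.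
  rewrite iterSr /commutator -!(signr_odd _ j) -(signr_odd _ j.+1) !mulr_sign.
  rewrite oddS exprS exprSr; case: (odd j) => /=; congr iter;
  by rewrite ?mulrN ?mulNr ?opprK -!mulrA.
have := leibniz_rule XS n 0 0 0; rewrite addn0 /X !expr0 !mul1r mulr1 => ->.
by apply: eq_bigr.
Qed.

(** In characteristic p the signs cancel: 'C(p.-1, l) = (-1)^l. *)
Lemma iter_commutator_pred (a b : R) :
  iter p.-1 (commutator a) b = \sum_(l < p) a ^+ l * b * a ^+ (p.-1 - l).
Proof.
have p_gt0 : (0 < p)%N := prime_gt0 (pcharf_prime pcharRp).
rewrite iter_commutator prednK //; apply: eq_bigr => l _.
have lep : (l <= p.-1)%N by rewrite -ltnS prednK.
rewrite -bin_sub // -mulr_natl mulrA bin_pred_pchar; last first.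
  by case: p p_gt0 l {lep} => // q _ l; rewrite ltnS leq_subr.
by rewrite -expr2 sqrr_sign mul1r.
Qed.

(** By [iter_commutator_pred], (ad a)^p b = [a, (ad a)^(p-1) b] is a
    telescoping sum. *)
Lemma iter_commutator_pchar (a b : R) :
  iter p (commutator a) b = commutator (a ^+ p) b.
Proof.
have p_gt0 : (0 < p)%N := prime_gt0 (pcharf_prime pcharRp).
rewrite -{1}(prednK p_gt0) iterS iter_commutator_pred /commutator.
pose f l := a ^+ l * b * a ^+ (p - l).
transitivity (f p - f 0); last by rewrite /f subnn subn0 !expr0 mulr1 mul1r.
rewrite -telescope_sumr // big_mkord mulr_sumr mulr_suml -sumrB.
apply: eq_bigr => -[l ltlp] _; rewrite /f /= [a ^+ l.+1]exprS.
have -> : (p - l = (p.-1 - l).+1)%N by lia.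
have -> : (p - l.+1 = p.-1 - l)%N by lia.
by rewrite exprSr !mulrA.
Qed.

Lemma deriv_exp_noncomm (P : {poly R}) n :
  (P ^+ n.+1)^`() = \sum_(l < n.+1) P ^+ l * P^`() * P ^+ (n - l).
Proof.
elim: n => [|n IHn]; first by rewrite big_ord1 !expr0 mul1r mulr1.
rewrite exprSr derivM IHn mulr_suml [RHS]big_ord_recr /= subnn expr0 mulr1.
congr (_ + _); apply: eq_bigr => l _.
by rewrite -!mulrA -exprSr subSn // -ltnS.
Qed.

End Commutators.

Section Jacobson.
Variables (F : fieldType) (p n : nat).

Definition gl : Type := 'M[F]_n.+1.

HB.instance Definition _ := GRing.NzRing.on gl.
HB.instance Definition _ := Vector.on gl.
HB.instance Definition _ := GRing.Algebra.on gl.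

Fact gl_lie_linearr (a : gl) : linear (commutator a).
Proof.
move=> k b c; rewrite /commutator mulrDr mulrDl opprD addrACA.
by rewrite -scalerAr -scalerAl scalerBr.
Qed.

Fact gl_lie_linearl (b : gl) : linear ((@commutator gl)^~ b).
Proof.
move=> k a c; rewrite /commutator mulrDr mulrDl opprD addrACA.
by rewrite -scalerAr -scalerAl scalerBr.
Qed.

Fact gl_liexx (a : gl) : commutator a a = 0.
Proof. exact: subrr. Qed.

Fact gl_jacobi (a b c : gl) : commutator a (commutator b c) +
  commutator b (commutator c a) + commutator c (commutator a b) = 0.
Proof.
rewrite /commutator !mulrBr !mulrBl !mulrA !opprB !addrA.
rewrite (ACl ((1*12)*(7*2)*(3*10)*(5*4)*(11*6)*(9*8)))%AC /=.
by rewrite !subrr !addr0.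
Qed.

HB.instance Definition _ := Vector_isLieAlgebra.Build F gl
  gl_lie_linearr gl_lie_linearl gl_liexx gl_jacobi.

Lemma gl_lieE (a b : gl) : lie a b = a * b - b * a.
Proof. by []. Qed.

(** The p-map is matrix p-th power, which satisfies the axioms only when F has
    characteristic p; the type therefore carries that hypothesis. *)
Definition res_gl of p \in [pchar F] : Type := gl.

Variable pcharFp : p \in [pchar F].

Let pcharGlp : p \in [pchar gl].
Proof. exact: (rmorph_pchar (GRing.in_alg gl)) pcharFp. Qed.

(** Identifies the recursive coefficients of Jacobson's polynomials with actual
    coefficients: (ad (a T + b))^m a is computed in matrices over F[T]. *)
Lemma coef_iter_commutator (a b : gl) m j :
  (iter m (commutator (a%:P * 'X + b%:P)) a%:P)`_j = lie_coef a b m j.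
Proof.
elim: m j => [|m IHm] j; first by rewrite coefC; case: j.
rewrite iterS /= -IHm; set P := iter m _ _.
have -> : commutator (a%:P * 'X + b%:P) P =
    commutator b%:P P + commutator a%:P P * 'X.
  rewrite /commutator mulrDl mulrDr -[_ * 'X * P]mulrA -(commr_polyX P).
  by rewrite opprD addrACA addrC mulrBl !mulrA.
rewrite coefD coefMX /commutator coefB coefCM coefMC; congr (_ + _).
by case: j => //= j; rewrite -IHm coefB coefCM coefMC.
Qed.

(** The coefficient of T^i in (a T + b)^p, for 0 < i < p, is found from the
    derivative in T: the derivative of the p-th power of P = a T + b is \sum_l
    P^l a P^(p-1-l) = (ad P)^(p-1) a. The formula is the evaluation of (a T +
    b)^p at T = 1. *)
Lemma gl_pmapD (a b : gl) : (a + b) ^+ p =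
  a ^+ p + b ^+ p + \sum_(1 <= i < p) jacobson_s p a b i.
Proof.
have p_gt0 : (0 < p)%N := prime_gt0 (pcharf_prime pcharFp).
pose P := a%:P * 'X + b%:P.
have PS m : (size (P ^+ m) <= m.+1)%N /\ (P ^+ m)`_m = a ^+ m.
  elim: m => [|m [szP IHm]]; first by rewrite !expr0 size_poly1 coef1.
  split.
    have szP2 : (size P <= 2)%N.
      by rewrite size_MXaddC; case: ifP => // _; rewrite ltnS size_polyC_leq1.
    rewrite exprS; apply: leq_trans (size_polyMleq _ _) _.
    by rewrite -subn1 leq_subLR (leq_add szP2 szP).
  rewrite exprS mulrDl -mulrA -commr_polyX mulrA coefD coefMX coefCM IHm.
  by rewrite coefCM (leq_sizeP _ _ szP) // mulr0 addr0 exprS.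
have P1 : P.[1] = a + b by rewrite hornerD hornerMX mulr1 !hornerC.
have P0 : P.[0] = b by rewrite hornerD hornerMX mulr0 add0r hornerC.
have coefP i : (0 < i < p)%N -> (P ^+ p)`_i = jacobson_s p a b i.
  case: i => // i /= ltip.
  have := coef_deriv (P ^+ p) i; rewrite -{1}(prednK p_gt0) deriv_exp_noncomm.
  have -> : P^`() = a%:P by rewrite derivMXaddC derivC mul0r addr0.
  have pcharP : p \in [pchar {poly gl}].
    exact: (rmorph_pchar (@polyC gl)) pcharGlp.
  rewrite prednK // -(iter_commutator_pred pcharP) coef_iter_commutator.
  move=> /(congr1 (fun c => i.+1%:R^-1 *: c)).
  rewrite /jacobson_s => ->; rewrite -scaler_nat scalerA mulVf ?scale1r //.
  by rewrite -(dvdn_pcharf pcharFp) gtnNdvd.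
have -> : (a + b) ^+ p = (P ^+ p).[1] by rewrite horner_exp_comm ?P1 //
  /comm_poly mul1r mulr1.
rewrite (horner_coef_wide _ (PS p).1) big_ord_recr /= (PS p).2 expr1n mulr1.
rewrite -(big_mkord xpredT (fun i => (P ^+ p)`_i * 1 ^+ i)) big_ltn // expr0
  mulr1.
rewrite -horner_coef0 horner_exp_comm; last by rewrite /comm_poly mul0r mulr0.
rewrite P0 addrC addrA; congr (_ + _); apply: eq_big_nat => i /coefP ->.
by rewrite expr1n mulr1.
Qed.

Local Notation G := (res_gl pcharFp).

HB.instance Definition _ := LieAlgebra.copy G gl.

Fact res_gl_lie_pmapl (a b : G) : lie ((a : gl) ^+ p) b = iter p (lie a) b.
Proof. by rewrite (iter_commutator_pchar pcharGlp). Qed.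

Fact res_gl_pmapZ k (a : G) : ((k *: a : G) : gl) ^+ p = k ^+ p *: ((a :
  gl) ^+ p).
Proof. by rewrite exprZn. Qed.

HB.instance Definition _ := LieAlgebra_isRestricted.Build p F G
  res_gl_lie_pmapl res_gl_pmapZ gl_pmapD.

End Jacobson.

(** * Restricted subalgebras *)

Section PSubalgebra.
Variables (p : nat) (F : fieldType) (L : resLieAlgType p F) (W : {vspace L}).

Definition p_sub (_ : p_subalgebra W) : Type := subvs_of W.
Variable pW : p_subalgebra W.

HB.instance Definition _ := Vector.copy (p_sub pW) (subvs_of W).
Local Notation S := (p_sub pW).

Definition p_sub_val (u : S) : L := vsval u.
Arguments p_sub_val : simpl never.
Definition p_sub_lie (u v : S) : S :=
  vsproj W (lie (p_sub_val u) (p_sub_val v)).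
Definition p_sub_pmap (u : S) : S := vsproj W (pmap (p_sub_val u)).

Fact p_sub_val_linear : linear p_sub_val. Proof. by []. Qed.
HB.instance Definition _ := GRing.isSemilinear.Build F S L _
  p_sub_val (GRing.semilinear_linear p_sub_val_linear).

Fact p_sub_val_inj : injective p_sub_val. Proof. exact: val_inj. Qed.
Fact p_sub_valP u : p_sub_val u \in W. Proof. exact: subvsP. Qed.

Fact p_sub_val_lie u v :
  p_sub_val (p_sub_lie u v) = lie (p_sub_val u) (p_sub_val v).
Proof. by rewrite [LHS]vsprojK // (proj1 pW) // p_sub_valP. Qed.

Fact p_sub_val_pmap u : p_sub_val (p_sub_pmap u) = pmap (p_sub_val u).
Proof. by rewrite [LHS]vsprojK // (proj2 pW) // p_sub_valP. Qed.

Fact p_sub_val0 : p_sub_val 0 = 0. Proof. by []. Qed.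
Fact p_sub_valD : {morph p_sub_val : u v / u + v}. Proof. by []. Qed.
Fact p_sub_valZ a : {morph p_sub_val : u / a *: u}. Proof. by []. Qed.

Fact p_sub_lie_linearr (u : S) : linear (p_sub_lie u).
Proof.
move=> a v w; refine (p_sub_val_inj _).
by rewrite !(p_sub_val_linear, p_sub_val_lie) lie_linearr.
Qed.

Fact p_sub_lie_linearl (v : S) : linear (p_sub_lie^~ v).
Proof.
move=> a u w; refine (p_sub_val_inj _).
by rewrite !(p_sub_val_linear, p_sub_val_lie) lie_linearl.
Qed.

Fact p_sub_liexx u : p_sub_lie u u = 0.
Proof. by refine (p_sub_val_inj _); rewrite p_sub_val_lie liexx. Qed.

Fact p_sub_jacobi u v w : p_sub_lie u (p_sub_lie v w) +
  p_sub_lie v (p_sub_lie w u) + p_sub_lie w (p_sub_lie u v) = 0.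
Proof.
by refine (p_sub_val_inj _); rewrite !(p_sub_valD, p_sub_val_lie) lie_jacobi.
Qed.

HB.instance Definition _ := Vector_isLieAlgebra.Build F S
  p_sub_lie_linearr p_sub_lie_linearl p_sub_liexx p_sub_jacobi.

Fact p_sub_val_morph (u v : S) :
  p_sub_val (lie u v) = lie (p_sub_val u) (p_sub_val v).
Proof. exact: p_sub_val_lie. Qed.

Fact p_sub_lie_pmapl (u v : S) : lie (p_sub_pmap u) v = iter p (lie u) v.
Proof.
have iterE m : p_sub_val (iter m (lie u) v) =
    iter m (lie (p_sub_val u)) (p_sub_val v).
  by elim: m => //= m <-; rewrite -p_sub_val_morph.
refine (p_sub_val_inj _).
by rewrite p_sub_val_morph p_sub_val_pmap lie_pmapl iterE.
Qed.

Fact p_sub_pmapZ a (u : S) : p_sub_pmap (a *: u) = a ^+ p *: p_sub_pmap u.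
Proof.
by refine (p_sub_val_inj _); rewrite !(p_sub_valZ, p_sub_val_pmap) pmapZ.
Qed.

Fact p_sub_val_coef (u v : S) n j :
  p_sub_val (lie_coef u v n j) = lie_coef (p_sub_val u) (p_sub_val v) n j.
Proof.
elim: n j => [|n IHn] [|j] /=;
  rewrite ?addr0 ?p_sub_valD ?p_sub_val_morph ?IHn //.
Qed.

Fact p_sub_pmapD (u v : S) : p_sub_pmap (u + v) =
  p_sub_pmap u + p_sub_pmap v + \sum_(1 <= i < p) jacobson_s p u v i.
Proof.
refine (p_sub_val_inj _).
rewrite !(p_sub_valD, p_sub_val_pmap) pmapD (big_morph _ p_sub_valD p_sub_val0).
congr (_ + _); apply: eq_bigr => i _.
by rewrite /jacobson_s p_sub_valZ p_sub_val_coef.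
Qed.

HB.instance Definition _ := LieAlgebra_isRestricted.Build p F S
  p_sub_lie_pmapl p_sub_pmapZ p_sub_pmapD.

End PSubalgebra.

(** * Recurrent sequences over a Lie module *)

Lemma bin_pexp_pchar (R : comNzRingType) p (pcharRp : p \in [pchar R]) e j :
  (0 < j < p ^ e)%N -> ('C(p ^ e, j))%:R = 0 :> R.
Proof.
move=> /andP[j_gt0 ltjp].
have pcharPp : p \in [pchar {poly R}] by rewrite (rmorph_pchar (@polyC R)).
have := @exprDn_pchar {poly R} 'X 1 (p ^ e); rewrite exprD1n expr1n.
rewrite (eq_pnat _ (pcharf_eq pcharPp)) pnatX pnat_id
  ?(pcharf_prime pcharRp) //.
move=> /(_ isT) /(congr1 (fun P : {poly R} => P`_j)).
rewrite coefD coefXn coef1 (gtn_eqF j_gt0) (ltn_eqF ltjp) !mulr0n addr0 => <-.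
rewrite coef_sum (bigD1 (Ordinal (ltnW ltjp : (j < (p ^ e).+1)%N))) //=.
rewrite coefMn coefXn eqxx big1 ?addr0 // => i; rewrite -val_eqE /= => ne_ij.
by rewrite coefMn coefXn eq_sym (negPf ne_ij) mul0rn.
Qed.

(** For an H-module V and a derivation D of H, the sequences in V are an
    H-module on which shift acts as a derivation compatible with D: the
    formulas (u f)(0) = u (f 0) and shift (u f) = (D u) f + u (shift f)
    determine the action, and make [shift, u] = D u. These sequences are the
    module coinduced from H to its extension by an element x with ad x = D on
    H; f corresponds to the linear map sending x^k to f k. *)
Section TwistedAction.
Variables (F : fieldType) (p : nat) (pcharFp : p \in [pchar F]).
Variables (L : lieAlgType F) (V : vectType F).
Variables (rho : 'Hom(L, 'End(V))) (D : 'End(L)).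
Implicit Types (u v : L) (f g : nat -> V).

Definition shift f : nat -> V := fun k => f k.+1.

Fixpoint twist (u : L) (f : nat -> V) (k : nat) : V :=
  if k is m.+1 then twist (D u) f m + twist u (shift f) m else rho u (f 0%N).

Lemma eq_twist u f g : f =1 g -> twist u f =1 twist u g.
Proof.
move=> eq_fg k; elim: k u f g eq_fg => [|k IHk] u f g eq_fg /=.
  by rewrite eq_fg.
by congr (_ + _); apply: IHk => // i; apply: eq_fg.
Qed.

Lemma twist_linearl f k : linear (fun u => twist u f k).
Proof.
elim: k f => [|k IHk] f a u v /=.
  by rewrite linearP add_lfunE scale_lfunE.
by rewrite linearP !IHk scalerDr addrACA.
Qed.

Lemma twist_linearr u a f g k :
  twist u (fun i => a *: f i + g i) k = a *: twist u f k + twist u g k.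
Proof.
elim: k u f g => [|k IHk] u f g /=; first by rewrite linearP.
by rewrite IHk (IHk u (shift f) (shift g)) scalerDr addrACA.
Qed.

Lemma twistDl u v f k : twist (u + v) f k = twist u f k + twist v f k.
Proof. by have := twist_linearl f k 1 u v; rewrite !scale1r. Qed.

Lemma twistDr u f g k :
  twist u (fun i => f i + g i) k = twist u f k + twist u g k.
Proof.
rewrite -[twist u f k]scale1r -twist_linearr; apply: eq_twist => i.
by rewrite scale1r.
Qed.

Lemma twist0l f k : twist 0 f k = 0.
Proof. by apply: (addIr (twist 0 f k)); rewrite -twistDl !add0r. Qed.

Lemma twist0r u k : twist u (fun=> 0) k = 0.
Proof.
by apply: (addIr (twist u (fun=> 0) k)); rewrite -twistDr !add0r.
Qed.

Lemma twistZl a u f k : twist (a *: u) f k = a *: twist u f k.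
Proof. by have := twist_linearl f k a u 0; rewrite twist0l !addr0. Qed.

Lemma twistZr u a f k : twist u (fun i => a *: f i) k = a *: twist u f k.
Proof.
rewrite -[RHS]addr0 -(twist0r u k) -twist_linearr.
by apply: eq_twist => i; rewrite addr0.
Qed.

Lemma twist_suml (I : Type) (r : seq I) (us : I -> L) f k :
  twist (\sum_(i <- r) us i) f k = \sum_(i <- r) twist (us i) f k.
Proof.
by elim: r => [|i r IHr]; rewrite ?big_nil ?twist0l // !big_cons twistDl IHr.
Qed.

Lemma twist_sumr (I : Type) (r : seq I) (fs : I -> nat -> V) u k :
  twist u (fun j => \sum_(i <- r) fs i j) k = \sum_(i <- r) twist u (fs i) k.
Proof.
elim: r => [|i r IHr].
  rewrite big_nil; apply: etrans (twist0r u k).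
  by apply: eq_twist => j; rewrite big_nil.
by rewrite big_cons -IHr -twistDr; apply: eq_twist => j; rewrite big_cons.
Qed.

Lemma iter_shift n f k : iter n shift f k = f (k + n)%N.
Proof. by elim: n k => [|n IHn] k /=; rewrite ?addn0 // /shift IHn addnS. Qed.

Lemma twist_iter n u f k : twist u f (k + n) =
  \sum_(l < n.+1) twist (iter l D u) (iter (n - l) shift f) k *+ 'C(n, l).
Proof.
pose X k' i j := twist (iter i D u) (iter j shift f) k'.
have XS k' i j : X k'.+1 i j = X k' i.+1 j + X k' i j.+1 by [].
by rewrite addnC -[LHS]/(X (n + k)%N 0%N 0%N) (leibniz_rule XS).
Qed.

(** As 'C(p ^ e, l) vanishes in F for 0 < l < p ^ e, the p ^ e-th power of the
    shift is again a derivation. *)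
Lemma twist_pexp e u f k : twist u f (k + p ^ e) =
  twist (iter (p ^ e) D u) f k + twist u (iter (p ^ e) shift f) k.
Proof.
rewrite twist_iter.
have [p_gt0 p_pr] := (prime_gt0 (pcharf_prime pcharFp), pcharf_prime pcharFp).
have := expn_gt0 p e; rewrite p_gt0 /=.
case: (p ^ e)%N (@bin_pexp_pchar F p pcharFp e) => // n binpe _.
rewrite big_ord_recr big_ord_recl /= subnn bin0 binn !mulr1n big1 ?addr0
  1?addrC // => l _.
rewrite -scaler_nat binpe ?scale0r //=.
by rewrite /bump /= add1n ltnS.
Qed.

Variables (m : nat) (c : 'I_m -> F).

Definition recurrent f := forall k,
  f (k + p ^ m)%N = \sum_(i < m) c i *: f (k + p ^ i)%N.

(** D and the shift satisfy the same p-polynomial relation, one on L and the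
    other on f; since every power occurring in it is a derivation, the relation
    holds on the product of u and f too. *)
Lemma twist_recurrent u f :
  (forall v, iter (p ^ m) D v = \sum_(i < m) c i *: iter (p ^ i) D v) ->
  recurrent f -> recurrent (twist u f).
Proof.
move=> Dm rec_f k; under eq_bigr do rewrite twist_pexp scalerDr.
rewrite big_split twist_pexp Dm /= twist_suml; congr (_ + _).
  by apply: eq_bigr => i _; rewrite twistZl.
under [RHS]eq_bigr do rewrite -twistZr.
rewrite -twist_sumr; apply: eq_twist => i; rewrite iter_shift rec_f.
by apply: eq_bigr => j _; rewrite iter_shift.
Qed.

Variables (H : {vspace L}).
Hypothesis D_der : forall u v, D (lie u v) = lie (D u) v + lie u (D v).
Hypothesis DH : forall u, u \in H -> D u \in H.
Hypothesis rho_lie : forall u v, u \in H -> v \in H ->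
  rho (lie u v) = (rho u \o rho v)%VF - (rho v \o rho u)%VF.

Lemma twist_lie u v f k : u \in H -> v \in H ->
  twist (lie u v) f k = twist u (twist v f) k - twist v (twist u f) k.
Proof.
elim: k u v f => [|k IHk] u v f Hu Hv /=.
  by rewrite rho_lie // add_lfunE opp_lfunE !comp_lfunE.
rewrite D_der twistDl !IHk ?DH //.
rewrite (@eq_twist v (shift (twist u f)) (fun i => twist (D u) f i + twist u
  (shift f) i)) //.
rewrite (@eq_twist u (shift (twist v f)) (fun i => twist (D v) f i + twist v
  (shift f) i)) //.
rewrite !twistDr !opprD !addrA.
by rewrite (ACl (1*3*5*4*2*6))%AC.
Qed.

End TwistedAction.

(** A sequence satisfying the recurrence is determined by its first p ^ m
    terms, which can be prescribed; this makes the space of these sequences a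
    finite-dimensional vector space with the shift as companion map. *)
Section LinearlyRecurrentSequences.
Variables (F : fieldType) (p : nat) (V : vectType F) (m : nat) (c : 'I_m -> F).
Hypothesis p_gt1 : (1 < p)%N.

Local Notation q := (p ^ m).-1.
Local Notation state := {ffun 'I_q.+1 -> V}.
Implicit Types (s : state) (f : nat -> V).

Let q1 : q.+1 = (p ^ m)%N.
Proof. by rewrite prednK // expn_gt0 ltnW. Qed.

Definition step s : state :=
  [ffun i : 'I_q.+1 => if (i < q)%N then s (inord i.+1)
           else \sum_(j < m) c j *: s (inord (p ^ j))].

Definition extend s : nat -> V := fun k => iter k step s ord0.

Definition initial f : state := [ffun i : 'I_q.+1 => f i].

Lemma step_linear : linear step.
Proof.
move=> a s t; apply/ffunP => i; rewrite [RHS]ffunE !ffunE.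
case: ifP => _ //.
rewrite scaler_sumr -big_split; apply: eq_bigr => j _.
by rewrite !ffunE scalerDr !scalerA mulrC.
Qed.

Lemma extend_linear a s t k :
  extend (a *: s + t) k = a *: extend s k + extend t k.
Proof.
rewrite /extend; have -> : iter k step (a *: s + t) = a *:
  iter k step s + iter k step t.
  by elim: k => //= k ->; rewrite step_linear.
by rewrite !ffunE.
Qed.

Lemma iter_step_inord s k i : (i <= q)%N ->
  iter k step s (inord i) = extend s (k + i).
Proof.
elim: i k => [|i IHi] k leiq.
  by rewrite addn0 /extend; congr (iter k step s _); apply: val_inj;
    rewrite /= inordK.
rewrite addnS -addSn -IHi 1?ltnW //= ffunE inordK ?leiq //.
by rewrite ltnS ltnW.
Qed.

Lemma extend_recurrent s : recurrent p c (extend s).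
Proof.
move=> k; rewrite -q1 addnS -addSn -iter_step_inord //= ffunE inordK // ltnn.
apply: eq_bigr => j _; rewrite iter_step_inord // -ltnS q1.
by rewrite ltn_exp2l.
Qed.

Lemma recurrent_extend f : recurrent p c f -> extend (initial f) =1 f.
Proof.
move=> rec_f k; have -> :
  extend (initial f) k = initial (fun i => f (k + i)%N) ord0.
  rewrite /extend; congr (fun_of_fin _ ord0); elim: k => [|k IHk] /=;
    first by [].

  rewrite IHk; apply/ffunP => i; rewrite !ffunE; case: ifP => [ltiq|/negbT].
    by rewrite inordK ?addnS.
  rewrite -leqNgt => leqi.
  have -> : i = q :> nat by apply/eqP; rewrite eqn_leq leqi -ltnS ltn_ord.
  rewrite (_ : k.+1 + q = k + p ^ m)%N ?rec_f; last by rewrite -q1 addnS.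
  apply: eq_bigr => j _; rewrite ffunE inordK //.
  by rewrite q1 ltn_exp2l.
by rewrite ffunE addn0.
Qed.

Lemma recurrent_shift f : recurrent p c f -> recurrent p c (shift f).
Proof. by move=> rec_f k; rewrite /shift -addSn rec_f. Qed.

Lemma recurrentD f g :
  recurrent p c f -> recurrent p c g -> recurrent p c (fun k => f k + g k).
Proof.
move=> rec_f rec_g k; rewrite rec_f rec_g -big_split.
by apply: eq_bigr => j _; rewrite scalerDr.
Qed.

Lemma recurrentZ a f : recurrent p c f -> recurrent p c (fun k => a *: f k).
Proof.
move=> rec_f k; rewrite rec_f scaler_sumr; apply: eq_bigr => j _.
by rewrite !scalerA mulrC.
Qed.

End LinearlyRecurrentSequences.

(** Otherwise the spans of the initial segments would grow in dimension for
    ever. *)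
Lemma dependent_sequence (F : fieldType) (E : vectType F) (e : nat -> E) :
  exists2 n, (0 < n)%N & e n \in <<mkseq e n>>%VS.
Proof.
suff [i /andP[i_gt0 ei]] : exists i : 'I_(\dim {:E}).+2,
    (0 < i)%N && (e i \in <<mkseq e i>>%VS) by exists i.
apply/existsP; apply: contraT; rewrite negb_exists => /forallP no_i.
have dim_ge n : (n <= (\dim {:E}).+1)%N -> (n <= \dim <<mkseq e n.+1>>)%N.
  elim: n => // n IHn ltn.
  have /= no_n := no_i (Ordinal (ltn : (n.+1 < (\dim {:E}).+2)%N)).
  apply: leq_ltn_trans (IHn (ltnW ltn)) _.
  have sub : (<<mkseq e n.+1>> <= <<mkseq e n.+2>>)%VS.
    apply: sub_span => x.
    by rewrite /mkseq -[n.+2]addn1 iotaD map_cat mem_cat => ->.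
  have [le_dim eq_dim] := dimv_leqif_sup sub.
  rewrite ltn_neqAle le_dim eq_dim andbT; apply: contra no_n => /subvP; apply.
  by apply: memv_span; apply/mapP; exists n.+1; rewrite ?mem_iota ?ltnSn.
by have := dim_ge _ (leqnn _); rewrite leqNgt ltnS dimvS // subvf.
Qed.

Lemma p_polynomial_relation (F : fieldType) (p : nat) (L : vectType F) (D :
  'End(L)) :
  exists2 m, (0 < m)%N & exists c : 'I_m -> F,
    forall v, iter (p ^ m) D v = \sum_(i < m) c i *: iter (p ^ i) D v.
Proof.
pose T k : 'End(L) := iter k (comp_lfun D) \1%VF.
have TE k v : T k v = iter k D v.
  by elim: k => [|k IHk] /=; rewrite ?id_lfunE // comp_lfunE IHk.
have [m m_gt0 Tm] := dependent_sequence (fun k => T (p ^ k)%N).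
exists m => //.
have sz : size (mkseq (fun k => T (p ^ k)%N) m) == m by rewrite size_mkseq.
exists (fun i => coord (Tuple sz) i (T (p ^ m)%N)) => v.
transitivity ((\sum_i coord (Tuple sz) i (T (p ^ m)%N) *: (Tuple sz)`_i) v).
  by rewrite -coord_span.
rewrite sum_lfunE.
by apply: eq_bigr => i _; rewrite scale_lfunE /= nth_mkseq // TE.
Qed.

(** * Faithful representations of soluble Lie algebras *)

Section ExtendRepresentation.
Variables (F : fieldType) (p : nat) (pcharFp : p \in [pchar F]).
Variables (L : lieAlgType F).

Definition faithful_on (W : {vspace L}) (V : vectType F)
    (rho : 'Hom(L, 'End(V))) :=
  (forall u v, u \in W -> v \in W ->
    rho (lie u v) = (rho u \o rho v)%VF - (rho v \o rho u)%VF) /\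
  (forall u, u \in W -> rho u = 0 -> u = 0).

Variables (W H : {vspace L}) (x : L) (a : {scalar L}).
Hypotheses (HE : forall u, (u \in H) = (u \in W) && (a u == 0)).
Hypotheses (Wx : x \in W) (ax : a x = 1).
Hypothesis WWH : forall u v, u \in W -> v \in W -> lie u v \in H.

(** Since a x = 1 and H is the kernel of a on W, each u in W is the sum of u -
    a u *: x in H and a multiple of x; x acts on the recurrent sequences by the
    shift and H by the twisted action. Faithfulness is seen on the term of
    index 0 of u f, which is h (f 0) + a u *: f 1 with h = u - a u *: x: here f
    0 and f 1 can be chosen freely because p ^ m > 1. *)
Lemma extend_faithful (V : vectType F) (rho : 'Hom(L, 'End(V))) :
  faithful_on H rho -> (exists v : V, v != 0) ->
  exists (V' : vectType F) (rho' : 'Hom(L, 'End(V'))),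
    faithful_on W rho' /\ exists v : V', v != 0.
Proof.
move=> [rho_lie rho_inj] [v0 v0_neq0].
have p_gt1 : (1 < p)%N := prime_gt1 (pcharf_prime pcharFp).
pose D : 'End(L) := linfun (lie x).
have [m m_gt0 [c Dm]] := p_polynomial_relation p D.
have DE u : D u = lie x u by rewrite lfunE.
have [q_def q_gt0] : (p ^ m).-1.+1 = (p ^ m)%N /\ (0 < (p ^ m).-1)%N.
  have := leq_pexp2l (ltnW p_gt1) m_gt0; rewrite expn1; lia.
pose h u := u - a u *: x.
have h_lin k u v : h (k *: u + v) = k *: h u + h v.
  by rewrite /h linearP scalerDl opprD addrACA scalerBr scalerA.
have Wh u : u \in W -> h u \in H.
  move=> Wu; rewrite HE memvB ?memvZ //= linearB linearZ /= ax.
  by rewrite mulr1 subrr.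
have Hh u : u \in H -> h u = u.
  by rewrite HE => /andP[_ /eqP au]; rewrite /h au scale0r subr0.
have HW u : u \in H -> u \in W by rewrite HE => /andP[].
have DH u : u \in H -> D u \in H by move=> /HW Wu; rewrite DE WWH.
have D_der u v : D (lie u v) = lie (D u) v + lie u (D v).
  by rewrite !DE lie_derivation.
pose act u (f : nat -> V) k := twist rho D (h u) f k + a u *: f k.+1.
have act_rec u f : recurrent p c f -> recurrent p c (act u f).
  move=> rec_f; apply: recurrentD; last exact/recurrentZ/recurrent_shift.
  exact: twist_recurrent.
have eq_act u f g : f =1 g -> act u f =1 act u g.
  by move=> eq_fg k; rewrite /act eq_fg (eq_twist _ _ _ eq_fg).
(* The terms a u *: twist (h v) (shift f) cancel; D (h u), D (h v) remain. *)
have act_lie u v f k : u \in W -> v \in W ->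
    act (lie u v) f k = act u (act v f) k - act v (act u f) k.
  move=> Wu Wv; have Hw := WWH Wu Wv.
  have aw : a (lie u v) = 0 by move: Hw; rewrite HE => /andP[_ /eqP].
  have uE z : z = h z + a z *: x by rewrite subrK.
  rewrite {1}/act Hh // aw scale0r addr0.
  have -> : lie u v = lie (h u) (h v) + (a u *: D (h v) - a v *: D (h u)).
    rewrite {1}[u]uE {1}[v]uE !DE; move: (h u) (h v) => y z.
    rewrite !lieDl !lieDr !lieZl !lieZr liexx !scaler0 addr0.
    by rewrite (lie_antisym y x) scalerN -addrA [X in _ + X]addrC.
  have actE z y :
    act z (act y f) k = twist rho D (h z) (twist rho D (h y) f) k +
      a y *: twist rho D (h z) (shift f) k + a z *: (twist rho D (D (h y)) f k +
      twist rho D (h y) (shift f) k + a y *: f k.+2).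
    rewrite {1}/act /act /=; congr (_ + _).
    by rewrite twistDr (twistZr _ _ _ _ (shift f)).
  rewrite !actE; move: (Wh u Wu) (Wh v Wv); move: (h u) (h v) => y z Hy Hz.
    rewrite twistDl twistDl -scaleNr !twistZl (twist_lie (H := H)) //.
  rewrite !scalerDr !scalerA !opprD !addrA scaleNr [a v * a u]mulrC.
  by rewrite [RHS](ACl ((1*6*3*8)*(2*9)*(4*7)*(5*10)))%AC /= !subrr !addr0.
pose S := {ffun 'I_(p ^ m).-1.+1 -> V}.
pose op u (s : S) : S := initial p m (act u (extend c s)).
have op_lin u : linear (op u).
  move=> k s t; apply/ffunP => i; rewrite !ffunE /act.
  rewrite (eq_twist _ _ _ (extend_linear c k s t)) twist_linearr.
  by rewrite extend_linear !scalerDr !scalerA [a u * k]mulrC addrACA.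
pose rho1 u := sval (linfunP (op_lin u)).
have rho1E u s : rho1 u s = op u s by rewrite /rho1; case: linfunP.
have rho1_lin : linear rho1.
  move=> k u v; apply/lfunP => s; rewrite add_lfunE scale_lfunE !rho1E.
  apply/ffunP => i; rewrite !ffunE /act h_lin twist_linearl linearP.
  by rewrite scalerDl !scalerDr scalerA addrACA.
have [rho' rho'E] := linfunP rho1_lin.
exists S, rho'; split; last first.
  exists (initial p m (fun=> v0)); apply/eqP => /ffunP/(_ ord0).
  by rewrite !ffunE => /eqP; apply/negP.
have opE u s : extend c (op u s) =1 act u (extend c s).
  exact/recurrent_extend/act_rec/extend_recurrent.
split=> [u v Wu Wv | u Wu u0].
  apply/lfunP => s; rewrite add_lfunE opp_lfunE !comp_lfunE !rho'E !rho1E.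
  apply/ffunP => i; rewrite !ffunE act_lie //.
  by congr (_ - _); apply/esym/eq_act/opE.
have act0 (s : S) : act u (extend c s) 0%N = 0.
  have := rho1E u s; rewrite -rho'E u0 zero_lfunE => /ffunP/(_ ord0).
  by rewrite !ffunE.
have ext0 (s : S) : extend c s 0%N = s ord0 by [].
have ext1 (s : S) : extend c s 1%N = s (inord 1)
  by exact: esym (iter_step_inord c s 0 q_gt0).
have rhoh v : rho (h u) v = 0.
  pose s : S := [ffun i => if i == ord0 then v else 0].
  have := act0 s; rewrite /act /= ext0 ext1 !ffunE eqxx ifN ?scaler0 ?addr0 //.
  by rewrite -val_eqE /= inordK.
have au : a u = 0.
  pose s : S := [ffun i => if i == inord 1 then v0 else 0].
  have := act0 s; rewrite /act /= rhoh add0r ext1 ffunE eqxx => /eqP.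
  by rewrite scaler_eq0 (negPf v0_neq0) orbF => /eqP.
have Hu : u \in H by rewrite HE Wu au eqxx.
by apply: rho_inj => //; apply/lfunP => v; rewrite zero_lfunE -(Hh u Hu).
Qed.

End ExtendRepresentation.

Lemma separating_form (F : fieldType) (L : vectType F) (W : {vspace L}) x :
  x \notin W -> exists2 a : {scalar L}, a x != 0 & forall u, u \in W -> a u = 0.
Proof.
move=> notWx; pose g : 'End(L) := (\1 - projv W)%VF.
have gE u : g u = u - projv W u by rewrite add_lfunE opp_lfunE id_lfunE.
have [i gxi] : exists i, coord (vbasis {:L}) i (g x) != 0.
  apply/existsP; apply: contraNT notWx; rewrite negb_exists => /forallP gx0.
  have : g x = 0.
    rewrite [LHS](coord_vbasis (memvf _)) big1 // => i _.
    by have := gx0 i; rewrite negbK => /eqP ->; rewrite scale0r.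
  by move/eqP; rewrite gE subr_eq0 => /eqP ->; apply: memv_proj.
exists (coord (vbasis {:L}) i \o g) => //= u Wu.
by rewrite gE projv_id // subrr linear0.
Qed.

Section SolubleSubalgebras.
Variables (F : fieldType) (L : lieAlgType F).
Implicit Types (U V W : {vspace L}).

Lemma lie_prodP U V u v : u \in U -> v \in V -> lie u v \in lie_prod U V.
Proof. exact: (lie_prod_subP U V _).2 (subvv _) u v. Qed.

Lemma lie_prodS U U' V V' : (U <= U')%VS -> (V <= V')%VS ->
  (lie_prod U V <= lie_prod U' V')%VS.
Proof.
move=> /subvP sU /subvP sV; apply/lie_prod_subP => u v Uu Vv.
by apply: lie_prodP; [apply: sU | apply: sV].
Qed.

(** A perfect subalgebra lies in every term of the derived series. *)
Lemma soluble_not_perfect W : soluble L -> W != 0%VS ->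
  exists2 x, x \in W & x \notin lie_prod W W.
Proof.
move=> [n sol] W0; apply/subvPn; apply: contra W0 => sWW.
have sub m : (W <= derived L m)%VS.
  elim: m => [|m IHm]; first exact: subvf.
  exact: subv_trans sWW (lie_prodS IHm IHm).
by rewrite -subv0 -sol.
Qed.

End SolubleSubalgebras.

(** A nonzero subalgebra W of L is not perfect, so a linear form vanishing on
    [W, W] but not on W cuts out an ideal of codimension 1 of W, to which the
    induction hypothesis applies. *)
Lemma soluble_faithful (F : fieldType) (p : nat) (pcharFp : p \in [pchar F])
    (L : lieAlgType F) : soluble L ->
  exists (V : vectType F) (rho : 'Hom(L, 'End(V))),
    faithful_on fullv rho /\ exists v : V, v != 0.
Proof.
move=> solL.
have rep0 : exists (V : vectType F) (rho : 'Hom(L, 'End(V))),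
    faithful_on 0%VS rho /\ exists v : V, v != 0.
  exists F^o, 0; split; last by exists 1; apply: oner_neq0.
  split=> [u v _ _|u]; last by rewrite memv0 => /eqP.
  by rewrite !zero_lfunE comp_lfun0l subrr.
suff rep n (W : {vspace L}) : (\dim W <= n)%N -> subalgebra W ->
    exists (V : vectType F) (rho : 'Hom(L, 'End(V))),
      faithful_on W rho /\ exists v : V, v != 0.
  by apply: (rep _ fullv (leqnn _)) => u v _ _; apply: memvf.
elim: n W => [|n IHn] W; have [-> _ _|W0 dimW subW] := eqVneq W 0%VS.
- exact: rep0.
- by move: dimW; rewrite leqn0 dimv_eq0 (negPf W0).
- exact: rep0.
have [w Ww WWw] := soluble_not_perfect solL W0.
have [a aw aWW] := separating_form WWw.
pose H := (W :&: lker (linfun (a : L -> F^o)))%VS.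
have HE u : (u \in H) = (u \in W) && (a u == 0).
  by rewrite memv_cap memv_ker lfunE.
have WWH u v : u \in W -> v \in W -> lie u v \in H.
  by move=> Wu Wv; rewrite HE subW //= aWW ?lie_prodP.
have subH : subalgebra H.
  by move=> u v; rewrite !HE => /andP[Wu _] /andP[Wv _]; rewrite -HE WWH.
have dimH : (\dim H <= n)%N.
  have sHW : (H <= W)%VS by apply: capvSl.
  have [le_d eq_d] := dimv_leqif_sup sHW.
  rewrite -ltnS; apply: leq_trans dimW; rewrite ltn_neqAle le_d eq_d andbT.
  by apply/subvPn; exists w; rewrite // HE Ww.
have [V [rho [rhoH V0]]] := IHn H dimH subH.
apply: (extend_faithful pcharFp (x := (a w)^-1 *: w) HE _ _ WWH rhoH V0).
  exact: memvZ.
by rewrite linearZ /= mulVf.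
Qed.

(** * Existence of p-envelopes *)

Lemma minimal_vspace (F : fieldType) (L : vectType F)
    (P : {vspace L} -> Prop) W :
  P W -> exists2 V, P V & forall V', P V' -> (V' <= V)%VS -> V' = V.
Proof.
elim: {W}(\dim W) {-2}W (leqnn (\dim W)) => [|n IHn] W dimW PW.
  exists W => // V' _ sV'W; apply/eqP; rewrite eqEdim sV'W.
  by apply: leq_trans dimW _.
have [[V' [PV' sV'W neq]]|minW] :=
    classic (exists V', [/\ P V', (V' <= W)%VS & V' != W]).
  apply: (IHn V') => //; rewrite -ltnS; apply: leq_trans dimW.
  have [le_d eq_d] := dimv_leqif_eq sV'W.
  by rewrite ltn_neqAle le_d eq_d neq.
exists W => // V' PV' sV'W; have [//|neq] := eqVneq V' W.
by case: minW; exists V'.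
Qed.

(** Matrices act on row vectors on the right, whence the exchange of factors;
    composing with negation turns this back into a Lie morphism. *)
Lemma matrix_antirep (F : fieldType) (V : vectType F) :
  (exists v : V, v != 0) ->
  exists n (j : 'Hom('End(V), 'M[F]_n.+1)), injective j /\
    forall f g, j (f \o g)%VF = j g *m j f.
Proof.
move=> [v v0]; pose e := vbasis {:V}.
have eP : basis_of {:V} e := vbasisP _.
have [j [j_inj jM]] : exists (j : 'Hom('End(V), 'M[F]_(\dim {:V}))),
    injective j /\ forall f g, j (f \o g)%VF = j g *m j f.
  have [j jE] := linfunP (passmx.mxof_linear e e).
  exists j; split=> [f g|f g]; rewrite !jE.
    exact: (can_inj (passmx.mxofK eP eP)).
  exact: passmx.mxof_comp.
have : (0 < \dim {:V})%N.
  rewrite lt0n dimv_eq0; apply: contra v0 => /eqP V0.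
  by rewrite -memv0 -V0 memvf.
by case: (\dim {:V}) j j_inj jM => // n j j_inj jM _; exists n, j.
Qed.

Section RestrictedMorphisms.
Variables (p : nat) (F : fieldType).

Definition res_morphism (L M : resLieAlgType p F) (f : 'Hom(L, M)) :=
  lie_morphism f /\ forall x, f (pmap x) = pmap (f x).

Lemma p_subalgebra_img (L M : resLieAlgType p F) (f : 'Hom(L, M)) V :
  res_morphism f -> p_subalgebra V -> p_subalgebra (f @: V)%VS.
Proof.
move=> [fL fp] [subV pV].
split=> [_ _ /memv_imgP[x Vx ->] /memv_imgP[y Vy ->]|_ /memv_imgP[x Vx ->]].
  by rewrite -fL memv_img ?subV.
by rewrite -fp memv_img ?pV.
Qed.

Lemma p_subalgebra_preim (L M : resLieAlgType p F) (f : 'Hom(L, M)) V :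
  res_morphism f -> p_subalgebra V -> p_subalgebra (f @^-1: V)%VS.
Proof.
move=> [fL fp] [subV pV]; split=> [x y|x]; rewrite -!memv_preim.
  by rewrite fL; apply: subV.
by rewrite fp; apply: pV.
Qed.

Lemma p_subalgebra_fullv (L : resLieAlgType p F) : p_subalgebra {:L}%VS.
Proof. by split=> [x y|x] *; apply: memvf. Qed.

End RestrictedMorphisms.

Section EnvelopeInSubalgebra.
Variables (p : nat) (F : fieldType) (U : lieAlgType F) (L : resLieAlgType p F).

(** A [p]-subalgebra containing the image and minimal for this property is an
    envelope. *)
Lemma p_envelope_of_embedding (i : 'Hom(U, L)) :
  lie_morphism i -> injective i ->
  exists (M : resLieAlgType p F) (j : 'Hom(U, M)), p_envelope j.
Proof.
move=> i_lie i_inj.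
have [W [pW sW] minW] : exists2 W, p_subalgebra W /\ (limg i <= W)%VS &
    forall V, p_subalgebra V /\ (limg i <= V)%VS -> (V <= W)%VS -> V = W.
  apply: (@minimal_vspace _ _ (fun V => p_subalgebra V /\ (limg i <= V)%VS)
    fullv).
  by rewrite subvf; split=> //; apply: p_subalgebra_fullv.
pose M : resLieAlgType p F := p_sub pW.
have [val valE] : {val : 'Hom(M, L) | val =1 @p_sub_val p F L W pW}.
  exact: linfunP (@p_sub_val_linear p F L W pW).
have val_res : res_morphism val.
  by split=> [x y|x]; rewrite !valE ?p_sub_val_morph ?p_sub_val_pmap.
have val_inj : injective val.
  by move=> x y; rewrite !valE => /p_sub_val_inj.
have val_img : limg val = W.
  apply/vspaceP => x; apply/memv_imgP/idP => [[y _ ->]|Wx].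
    by rewrite valE p_sub_valP.
  by exists (vsproj W x); rewrite ?memvf // valE [RHS]vsprojK.
have Wi u : i u \in limg val by rewrite val_img (subvP sW) ?memv_img ?memvf.
pose j : 'Hom(U, M) := (val^-1 \o i)%VF.
have jE u : val (j u) = i u by rewrite comp_lfunE limg_lfunVK.
exists M, j; split.
- by move=> u v; apply: val_inj; rewrite val_res.1 !jE.
- by move=> u v eq_j; apply: i_inj; rewrite -!jE eq_j.
move=> V pV sV.
have VW : (val @: V)%VS = W.
  apply: minW; last by rewrite -val_img limgS ?subvf.
  split; first exact: p_subalgebra_img.
  apply/subvP => _ /memv_imgP[u _ ->]; rewrite -jE memv_img //.
  by apply: (subvP sV); rewrite memv_img ?memvf.
apply/vspaceP => x; rewrite memvf.
have : val x \in (val @: V)%VS by rewrite VW -val_img memv_img ?memvf.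
by case/memv_imgP=> y Vy /val_inj ->.
Qed.

End EnvelopeInSubalgebra.

Theorem p_envelope_exists (F : fieldType) (p : nat) (pcharFp : p \in [pchar F])
    (U : lieAlgType F) : soluble U ->
  exists (M : resLieAlgType p F) (j : 'Hom(U, M)), p_envelope j.
Proof.
move=> /(soluble_faithful pcharFp)[V [rho [[rho_lie rho_inj] /matrix_antirep]]].
move=> [n [j [j_inj jM]]].
pose i : 'Hom(U, res_gl n pcharFp) := (- (j \o rho))%VF.
have iE u : i u = - j (rho u) by rewrite opp_lfunE comp_lfunE.
apply: (p_envelope_of_embedding (i := i)) => [u v|u v].
  rewrite !iE rho_lie ?memvf // linearB /= !jM [RHS]gl_lieE !mulrNN opprB.
  by [].
rewrite !iE => /oppr_inj /j_inj /eqP; rewrite -subr_eq0 -linearB => /eqP.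
by move/rho_inj => /(_ (memvf _)) /eqP; rewrite subr_eq0 => /eqP.
Qed.

(** * Surjections and quotients *)

Section Surjections.
Variables (F : fieldType).

Definition surjective (L M : vectType F) (f : 'Hom(L, M)) :=
  forall y, exists x, f x = y.

Lemma surjective_limg (L M : vectType F) (f : 'Hom(L, M)) :
  surjective f -> limg f = fullv.
Proof.
move=> f_surj; apply/vspaceP => y; rewrite memvf; have [x <-] := f_surj y.
by rewrite memv_img ?memvf.
Qed.

Lemma surjective_bijective (L M : vectType F) (f : 'Hom(L, M)) :
  surjective f -> injective f -> bijective f.
Proof.
move=> f_surj /lker0P f_inj; exists (f^-1)%VF; first exact: lker0_lfunK.
by move=> y; rewrite limg_lfunVK // surjective_limg ?memvf.
Qed.

Lemma surjective_comp (L M N : vectType F) (f : 'Hom(L, M)) (g : 'Hom(M, N)) :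
  surjective f -> surjective g -> surjective (g \o f)%VF.
Proof.
move=> f_surj g_surj z; have [y <-] := g_surj z; have [x <-] := f_surj y.
by exists x; rewrite comp_lfunE.
Qed.

Lemma factor_surjection (L M N : vectType F) (f : 'Hom(L, M)) (g : 'Hom(L, N)) :
  surjective f -> (forall x, f x = 0 -> g x = 0) ->
  exists h : 'Hom(M, N), forall x, h (f x) = g x.
Proof.
move=> f_surj kfg; exists (g \o f^-1)%VF => x; rewrite comp_lfunE.
apply/eqP; rewrite -subr_eq0 -linearB; apply/eqP/kfg.
by rewrite linearB /= limg_lfunVK ?subrr // memv_img ?memvf.
Qed.

End Surjections.

Section LieMorphisms.
Variables (F : fieldType).
Implicit Types L M N : lieAlgType F.

Lemma lie_morphism_comp L M N (f : 'Hom(L, M)) (g : 'Hom(M, N)) :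
  lie_morphism f -> lie_morphism g -> lie_morphism (g \o f)%VF.
Proof. by move=> fL gL x y; rewrite !comp_lfunE fL gL. Qed.

Lemma lie_morphism_factor L M N (f : 'Hom(L, M)) (g : 'Hom(L, N)) (h : 'Hom(M,
  N)) :
  surjective f -> lie_morphism f -> lie_morphism g ->
  (forall x, h (f x) = g x) -> lie_morphism h.
Proof.
move=> f_surj fL gL hE x y; have [x' <-] := f_surj x; have [y' <-] := f_surj y.
by rewrite -fL !hE gL.
Qed.

Lemma ideal_lker L M (f : 'Hom(L, M)) : lie_morphism f -> ideal (lker f).
Proof.
by move=> fL x y; rewrite !memv_ker fL => /eqP ->; rewrite lie0r.
Qed.

Lemma ideal_img L M (f : 'Hom(L, M)) K :
  lie_morphism f -> surjective f -> ideal K -> ideal (f @: K)%VS.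
Proof.
move=> fL f_surj idK x _ /memv_imgP[y Ky ->]; have [x' <-] := f_surj x.
by rewrite -fL memv_img ?idK.
Qed.

Lemma ideal_preim L M (f : 'Hom(L, M)) K :
  lie_morphism f -> ideal K -> ideal (f @^-1: K)%VS.
Proof. by move=> fL idK x y; rewrite -!memv_preim fL; apply: idK. Qed.

Lemma quot_projP L (K : {vspace L}) (idK : ideal K) :
  exists f : 'Hom(L, quot idK),
  [/\ lie_morphism f, surjective f & forall x, (f x == 0) = (x \in K)].
Proof.
have [f fE] : {f : 'Hom(L, quot idK) | f =1 quot_proj K}.
  exact: (linfunP (@quot_proj_linear F L K)).
exists f; split=> [x y|y|x].
- by rewrite !fE; apply: (quot_proj_lie x y idK).
- by exists (vsval y); rewrite fE; apply: quot_projK.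
by rewrite fE; apply: quot_proj_eq0.
Qed.

Lemma quot_lker_iso L M (f : 'Hom(L, M)) (idK : ideal (lker f)) :
  lie_morphism f -> surjective f -> lie_iso (quot idK) M.
Proof.
move=> fL f_surj; have [g [gL g_surj gE]] := quot_projP idK.
have [|h hE] := factor_surjection (g := f) g_surj.
  by move=> x /eqP; rewrite gE memv_ker => /eqP.
exists h; split; first exact: lie_morphism_factor hE.
apply: surjective_bijective => [y|].
  by have [x <-] := f_surj y; exists (g x).
apply/lker0P; rewrite -subv0; apply/subvP => y; have [x <-] := g_surj y.
by rewrite memv_ker hE memv0 gE memv_ker.
Qed.

Lemma lie_iso_sym L M : lie_iso L M -> lie_iso M L.
Proof.
move=> [f [fL [g fK gK]]]; have f_inj := can_inj fK.
have fV y : (f^-1)%VF y = g y.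
  by rewrite -{1}(gK y) lker0_lfunK //; apply/lker0P.
exists (f^-1)%VF; split; last by exists f => x; rewrite fV.
by move=> x y; apply: f_inj; rewrite fL !fV !gK.
Qed.

Lemma bij_surjective L M (f : 'Hom(L, M)) : bijective f -> surjective f.
Proof. by case=> g _ gK y; exists (g y). Qed.

Lemma primitive_iso L M : lie_iso L M -> primitive L -> primitive M.
Proof.
move=> [f [fL f_bij]] [A [[idA A0 minA] cA]].
have [f_surj f_inj] := (bij_surjective f_bij, bij_inj f_bij).
have f0 : lker f == 0%VS by apply/lker0P.
exists (f @: A)%VS; split; first split.
- exact: ideal_img.
- by rewrite -(limg0 f) eq_limg_ker0.
- move=> B idB sBA; have Bimg : (f @: (f @^-1: B))%VS = B.
    by rewrite lpreimK // surjective_limg ?subvf.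
  case: (minA (f @^-1: B)%VS).
  + exact: ideal_preim.
  + by rewrite -(limg_ker0 _ _ f0) Bimg.
  + by move=> B0; left; rewrite -Bimg B0 limg0.
  by move=> BA; right; rewrite -Bimg BA.
move=> y; have [x <-] := f_surj y; split=> [cx|/memv_imgP[x' Ax' /f_inj ->]].
  apply: memv_img; apply/cA => a Aa; apply: f_inj.
  by rewrite fL cx ?memv_img ?linear0.
by move=> _ /memv_imgP[a Aa ->]; rewrite -fL (cA x').2 ?linear0.
Qed.

(** Replaces the concrete quotients by arbitrary surjections, so that quotients
    of quotients need no isomorphism theorem. *)
Lemma primitive_closureP (X : lie_class F) L : iso_closed X ->
  primitive_closure X L <-> soluble L /\
  forall M (f : 'Hom(L, M)), lie_morphism f -> surjective f -> primitive M ->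
    X M.
Proof.
move=> isoX; split=> -[solL XL]; split.
- by [].
- move=> M f fL f_surj primM.
  have isoM := quot_lker_iso (ideal_lker fL) fL f_surj.
  by apply: (isoX _ _ isoM); apply: XL; apply:
    primitive_iso (lie_iso_sym isoM) _.
- by [].
- move=> K idK.
  by have [f [fL f_surj _]] := quot_projP idK; apply: XL f_surj.
Qed.

Lemma derived_img L M (f : 'Hom(L, M)) n :
  lie_morphism f -> surjective f -> (derived M n <= f @: derived L n)%VS.
Proof.
move=> fL f_surj; elim: n => [|n IHn] /=; first by rewrite surjective_limg.
apply/lie_prod_subP => u v /(subvP IHn)/memv_imgP[x Dx ->{u}].
move=> /(subvP IHn)/memv_imgP[y Dy ->{v}].
by rewrite -fL memv_img ?lie_prodP.
Qed.

Lemma soluble_img L M (f : 'Hom(L, M)) :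
  lie_morphism f -> surjective f -> soluble L -> soluble M.
Proof.
move=> fL f_surj [n Ln]; exists n; apply/eqP; rewrite -subv0.
by have := derived_img n fL f_surj; rewrite Ln limg0.
Qed.

Lemma soluble_sub L M (f : 'Hom(L, M)) :
  lie_morphism f -> injective f -> soluble M -> soluble L.
Proof.
move=> fL /lker0P f0 [n Mn]; exists n; apply/eqP;
  rewrite -subv0 -(limg_ker0 _ _ f0).
rewrite limg0 -Mn; elim: n {Mn} => [|n IHn]; first by rewrite subvf.
apply/subvP => _ /memv_imgP[z Dz ->]; rewrite memv_preim; move: z Dz;
  apply/subvP.
apply/lie_prod_subP => x y Dx Dy; rewrite -memv_preim fL.
by apply: lie_prodP; apply: (subvP IHn); apply: memv_img.
Qed.

End LieMorphisms.

Section ResMorphisms.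
Variables (p : nat) (F : fieldType).
Implicit Types L M N : resLieAlgType p F.

Lemma res_morphism_comp L M N (f : 'Hom(L, M)) (g : 'Hom(M, N)) :
  res_morphism f -> res_morphism g -> res_morphism (g \o f)%VF.
Proof.
move=> [fL fp] [gL gp]; split; first exact: lie_morphism_comp.
by move=> x; rewrite !comp_lfunE fp gp.
Qed.

Lemma res_morphism_factor L M N (f : 'Hom(L, M)) (g : 'Hom(L, N)) (h : 'Hom(M,
  N)) :
  surjective f -> res_morphism f -> res_morphism g ->
  (forall x, h (f x) = g x) -> res_morphism h.
Proof.
move=> f_surj [fL fp] [gL gp] hE; split; first exact: lie_morphism_factor hE.
by move=> x; have [x' <-] := f_surj x; rewrite -fp !hE gp.
Qed.

Lemma pmap0 L : (0 < p)%N -> pmap (0 : L) = 0.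
Proof.
move=> p_gt0; have := pmapZ 0 (0 : L).
by rewrite expr0n eqn0Ngt p_gt0 !scale0r.
Qed.

Lemma p_ideal_lker L M (f : 'Hom(L, M)) : (0 < p)%N ->
  res_morphism f -> p_ideal (lker f).
Proof.
move=> p_gt0 [fL fp]; split; first exact: ideal_lker.
by move=> x; rewrite !memv_ker fp => /eqP ->; rewrite pmap0.
Qed.

Lemma p_ideal_img L M (f : 'Hom(L, M)) K :
  res_morphism f -> surjective f -> p_ideal K -> p_ideal (f @: K)%VS.
Proof.
move=> [fL fp] f_surj [idK pK]; split; first exact: ideal_img.
by move=> _ /memv_imgP[x Kx ->]; rewrite -fp memv_img ?pK.
Qed.

Lemma p_ideal_preim L M (f : 'Hom(L, M)) K :
  res_morphism f -> p_ideal K -> p_ideal (f @^-1: K)%VS.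
Proof.
move=> [fL fp] [idK pK]; split; first exact: ideal_preim.
by move=> x; rewrite -!memv_preim fp; apply: pK.
Qed.

Lemma p_quot_projP L (K : {vspace L}) (pidK : p_ideal K) :
  exists f : 'Hom(L, p_quot pidK),
  [/\ res_morphism f, surjective f & forall x, (f x == 0) = (x \in K)].
Proof.
have [f fE] : {f : 'Hom(L, p_quot pidK) | f =1 quot_proj K}.
  exact: (linfunP (@quot_proj_linear F L K)).
exists f; split=> [|y|x].
- split=> [x y|x]; rewrite !fE; first exact: (quot_proj_lie x y (proj1 pidK)).
  exact/esym/quot_proj_pmap.
- by exists (vsval y); rewrite fE; apply: quot_projK.
by rewrite fE; apply: quot_proj_eq0.
Qed.

Lemma p_quot_lker_iso L M (f : 'Hom(L, M)) (pidK : p_ideal (lker f)) :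
  res_morphism f -> surjective f -> res_lie_iso (p_quot pidK) M.
Proof.
move=> fR f_surj; have [g [gR g_surj gE]] := p_quot_projP pidK.
have [|h hE] := factor_surjection (g := f) g_surj.
  by move=> x /eqP; rewrite gE memv_ker => /eqP.
have [hL hp] := res_morphism_factor g_surj gR fR hE.
exists h; split=> //; apply: surjective_bijective => [y|].
  by have [x <-] := f_surj y; exists (g x).
apply/lker0P; rewrite -subv0; apply/subvP => y; have [x <-] := g_surj y.
by rewrite memv_ker hE memv0 gE memv_ker.
Qed.

Lemma res_lie_iso_sym L M : res_lie_iso L M -> res_lie_iso M L.
Proof.
move=> [f [fL fp [g fK gK]]]; have f_inj := can_inj fK.
have fV y : (f^-1)%VF y = g y.
  by rewrite -{1}(gK y) lker0_lfunK //; apply/lker0P.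
exists (f^-1)%VF; split; last by exists f => x; rewrite fV.
  by move=> x y; apply: f_inj; rewrite fL !fV !gK.
by move=> x; apply: f_inj; rewrite fp !fV !gK.
Qed.

Lemma p_primitive_iso L M : res_lie_iso L M -> p_primitive L -> p_primitive M.
Proof.
move=> [f [fL fp f_bij]] [A [[idA A0 minA] cA]].
have [f_surj f_inj] := (bij_surjective f_bij, bij_inj f_bij).
have f0 : lker f == 0%VS by apply/lker0P.
exists (f @: A)%VS; split; first split.
- exact: p_ideal_img.
- by rewrite -(limg0 f) eq_limg_ker0.
- move=> B idB sBA; have Bimg : (f @: (f @^-1: B))%VS = B.
    by rewrite lpreimK // surjective_limg ?subvf.
  case: (minA (f @^-1: B)%VS).
  + exact: p_ideal_preim.
  + by rewrite -(limg_ker0 _ _ f0) Bimg.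
  + by move=> B0; left; rewrite -Bimg B0 limg0.
  by move=> BA; right; rewrite -Bimg BA.
move=> y; have [x <-] := f_surj y; split=> [cx|/memv_imgP[x' Ax' /f_inj ->]].
  apply: memv_img; apply/cA => a Aa; apply: f_inj.
  by rewrite fL cx ?memv_img ?linear0.
by move=> _ /memv_imgP[a Aa ->]; rewrite -fL (cA x').2 ?linear0.
Qed.

Lemma p_primitive_closureP (X : res_lie_class p F) L : (0 < p)%N ->
  p_iso_closed X ->
  p_primitive_closure X L <-> soluble L /\
  forall M (f : 'Hom(L, M)), res_morphism f -> surjective f -> p_primitive M ->
    X M.
Proof.
move=> p_gt0 isoX; split=> -[solL XL]; split.
- by [].
- move=> M f fL f_surj primM.
  have isoM := p_quot_lker_iso (p_ideal_lker p_gt0 fL) fL f_surj.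
  by apply: (isoX _ _ isoM); apply: XL; apply:
    p_primitive_iso (res_lie_iso_sym isoM) _.
- by [].
- move=> K idK.
  by have [f [fL f_surj _]] := p_quot_projP idK; apply: XL f_surj.
Qed.

End ResMorphisms.

(** * Transporters and p-envelopes *)

Section Transporters.
Variables (F : fieldType) (L : lieAlgType F).
Implicit Types (A B : {vspace L}) (x : L).

(** The subspace {x | [x, A] <= B}; normalisers, centralisers and the centre
    are the cases B = A, B = 0, and A = L with B = 0. *)
Definition transporter A B : {vspace L} :=
  (\bigcap_(i < \dim A) (linfun (lier (vbasis A)`_i) @^-1: B))%VS.

Lemma transporterP A B x :
  reflect (forall a, a \in A -> lie x a \in B) (x \in transporter A B).
Proof.
apply: (iffP idP) => [xAB a /coord_vbasis -> | xAB].
  rewrite linear_sum memv_suml // => i _; rewrite linearZ memvZ //=.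
  have := subv_bigcapP (subvv (transporter A B)) i isT => /subvP/(_ x xAB).
  by rewrite -memv_preim lfunE.
rewrite memvE; apply/subv_bigcapP => i _; rewrite -memvE -memv_preim lfunE.
by apply: xAB; apply: vbasis_mem; rewrite mem_nth ?size_tuple.
Qed.

Lemma subalgebra_transporter A B : (B <= A)%VS -> subalgebra (transporter A B).
Proof.
move=> /subvP sBA x y /transporterP xAB /transporterP yAB.
apply/transporterP => a Aa.
have -> : lie (lie x y) a = lie x (lie y a) - lie y (lie x a).
  by rewrite (lie_derivation x y a) addrK.
by rewrite memvB ?xAB ?yAB // sBA ?xAB ?yAB.
Qed.

Lemma ideal_transporter A B : ideal A -> ideal B -> ideal (transporter A B).
Proof.
move=> idA idB x y /transporterP yAB; apply/transporterP => a Aa.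
have -> : lie (lie x y) a = lie x (lie y a) - lie y (lie x a).
  by rewrite (lie_derivation x y a) addrK.
by apply: memvB; [apply: idB; apply: yAB | apply: yAB; apply: idA].
Qed.

Lemma ideal0 : ideal (0%VS : {vspace L}).
Proof. by move=> x y; rewrite !memv0 => /eqP ->; rewrite lie0r. Qed.

Lemma ideal_fullv : ideal {:L}%VS.
Proof. by move=> x y _; apply: memvf. Qed.

Definition centre : {vspace L} := transporter fullv 0.

Lemma centreP x : reflect (forall y, lie x y = 0) (x \in centre).
Proof.
apply: (iffP (transporterP _ _ _)) => [xL y|xL y _]; last by rewrite xL mem0v.
by apply/eqP; rewrite -memv0 xL ?memvf.
Qed.

Lemma ideal_centre : ideal centre.
Proof. exact: ideal_transporter ideal_fullv ideal0. Qed.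

End Transporters.

Arguments centre {F} L.

Section RestrictedTransporters.
Variables (p : nat) (p_gt0 : (0 < p)%N) (F : fieldType) (L : resLieAlgType p F).
Implicit Types (A B : {vspace L}) (x : L).

(** As B <= A, the operator (ad x)^p, for p > 0, maps A into B if ad x does. *)
Lemma p_closed_transporter A B : (B <= A)%VS -> p_closed (transporter A B).
Proof.
move=> /subvP sBA x /transporterP xAB; apply/transporterP => a Aa.
have iterB n : iter n.+1 (lie x) a \in B.
  by elim: n => [|n IHn]; [apply: xAB | rewrite iterS; apply: xAB; apply: sBA].
by rewrite lie_pmapl; have := iterB p.-1; rewrite prednK.
Qed.

Lemma p_subalgebra_transporter A B : (B <= A)%VS ->
  p_subalgebra (transporter A B).
Proof.
by move=> sBA; split; [apply: subalgebra_transporter | apply: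
  p_closed_transporter].
Qed.

Lemma p_ideal_centre : p_ideal (centre L).
Proof.
split; first exact: ideal_centre.
by apply: p_closed_transporter; apply: sub0v.
Qed.

Lemma central_quotient : exists (N : resLieAlgType p F) (pi : 'Hom(L, N)),
  [/\ res_morphism pi, surjective pi & forall x,
    (pi x == 0) = (x \in centre L)].
Proof.
by have [pi piP] := p_quot_projP p_ideal_centre;
  exists (p_quot p_ideal_centre), pi.
Qed.

End RestrictedTransporters.

Section Envelopes.
Variables (p : nat) (p_gt0 : (0 < p)%N) (F : fieldType).
Variables (U : lieAlgType F) (L : resLieAlgType p F) (i : 'Hom(U, L)).
Hypothesis env_i : p_envelope i.

Let i_lie : lie_morphism i. Proof. by case: env_i. Qed.

(** The induction principle of envelopes: what holds on U and defines a
    [p]-subalgebra holds on L. *)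
Lemma p_envelope_ind (W : {vspace L}) : p_subalgebra W ->
  (forall u, i u \in W) -> W = fullv.
Proof.
move=> pW iW; have [_ _] := env_i; apply=> //.
by apply/subvP => _ /memv_imgP[u _ ->].
Qed.

Lemma p_envelope_transporter (A B : {vspace L}) : (B <= A)%VS ->
  (forall u a, a \in A -> lie (i u) a \in B) ->
  forall x a, a \in A -> lie x a \in B.
Proof.
move=> sBA iAB x; apply/transporterP.
rewrite (p_envelope_ind (p_subalgebra_transporter p_gt0 sBA)) ?memvf // => u.
by apply/transporterP => a; apply: iAB.
Qed.

Lemma p_envelope_ideal (K : {vspace U}) : ideal K -> ideal (i @: K)%VS.
Proof.
move=> idK; apply: p_envelope_transporter => // u _ /memv_imgP[v Kv ->].
by rewrite -i_lie memv_img ?idK.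
Qed.

(** U is an ideal of L, hence U acts on L with values in U; the latter property
    defines a transporter, so it passes from U to L. *)
Lemma p_envelope_derived x y : lie x y \in limg i.
Proof.
have := @p_envelope_transporter fullv (limg i) (subvf _) _ x y (memvf _).
apply=> u a _; rewrite lie_antisym memvN.
by apply: (p_envelope_ideal (@ideal_fullv _ U)); rewrite memv_img ?memvf.
Qed.

Lemma p_envelope_lie x u : exists v, lie x (i u) = i v.
Proof. by have /memv_imgP[v _ ->] := p_envelope_derived x (i u); exists v. Qed.

(** The elements acting trivially on x form a [p]-subalgebra containing U. *)
Lemma p_envelope_centre x :
  (forall u, lie x (i u) = 0) -> x \in centre L.
Proof.
move=> xi0; apply/centreP => y; rewrite lie_antisym; apply/eqP;
  rewrite oppr_eq0.
have cx : (0 <= <[x]>)%VS by apply: sub0v.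
rewrite -memv0; apply: (p_envelope_transporter cx) => [u a /vlineP[k ->]|].
  by rewrite lieZr lie_antisym xi0 oppr0 scaler0 mem0v.
exact: memv_line.
Qed.

Lemma p_envelope_soluble : soluble U -> soluble L.
Proof.
move=> [n Un]; exists n.+1; apply/eqP; rewrite -subv0 -(limg0 i) -Un.
elim: n {Un} => [|n IHn] /=.
  by apply/lie_prod_subP => x y _ _; apply: p_envelope_derived.
apply/lie_prod_subP => x y /(subvP IHn)/memv_imgP[u Du ->{x}].
move=> /(subvP IHn)/memv_imgP[v Dv ->{y}].
by rewrite -i_lie memv_img ?lie_prodP.
Qed.

End Envelopes.

(** * Comparison of p-envelopes *)

Section Actions.
Variables (p : nat) (p_gt0 : (0 < p)%N) (F : fieldType).
Variables (U V : lieAlgType F) (L : resLieAlgType p F).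
Variables (i : 'Hom(U, L)) (phi : 'Hom(U, V)).
Hypotheses (env_i : p_envelope i) (phi_lie : lie_morphism phi).
Hypothesis phi_surj : surjective phi.

(** d is the action of L on V = U / ker phi by derivations. It is specified
    through pairs [x, i u] = i v, as i and phi have no canonical inverses. *)
Definition induced_action (d : 'Hom(L, 'End(V))) :=
  forall x u v, lie x (i u) = i v -> d x (phi u) = phi v.

Let i_inj : injective i. Proof. by case: env_i. Qed.

Lemma induced_action_exists : exists d, induced_action d.
Proof.
have i0 : lker i == 0%VS by apply/lker0P.
pose d x : 'End(V) := (phi \o (i^-1 \o (linfun (lie x) \o (i \o phi^-1))))%VF.
have dE x v : d x v = phi (i^-1 (lie x (i (phi^-1 v))))%VF.
  by rewrite !comp_lfunE lfunE.
have [d' d'E] : {d' : 'Hom(L, 'End(V)) | d' =1 d}.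
  apply: linfunP => a x y; apply/lfunP => v.
  by rewrite add_lfunE scale_lfunE !dE lie_linearl !linearP.
exists d' => x u v xu; rewrite d'E dE.
set u' := (phi^-1)%VF _.
have k_u : u' - u \in lker phi.
  by rewrite memv_ker linearB /= limg_lfunVK ?subrr // memv_img ?memvf.
have /memv_imgP[w kw xw] : lie x (i (u' - u)) \in (i @: lker phi)%VS.
  by apply: p_envelope_ideal (ideal_lker phi_lie) _ _ _; rewrite ?memv_img.
have -> : lie x (i u') = i (v + w).
  by rewrite linearD /= -xw -xu -lieDr -linearD addrC subrK.
rewrite lker0_lfunK // linearD /=.
by move: kw; rewrite memv_ker => /eqP ->; rewrite addr0.
Qed.

Variables (d : 'Hom(L, 'End(V))) (dP : induced_action d).

Lemma induced_action_lie x y : d (lie x y) = (d x \o d y)%VF - (d y \o d x)%VF.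
Proof.
apply/lfunP => v; have [u <-] := phi_surj v.
have [ux xu] := p_envelope_lie p_gt0 env_i x u.
have [uy yu] := p_envelope_lie p_gt0 env_i y u.
have [uxy xyu] := p_envelope_lie p_gt0 env_i x uy.
have [uyx yxu] := p_envelope_lie p_gt0 env_i y ux.
rewrite add_lfunE opp_lfunE !comp_lfunE (dP yu) (dP xu) (dP xyu) (dP yxu).
rewrite -linearB; apply: dP; rewrite linearB /= -xyu -yxu -yu -xu.
by rewrite (lie_derivation x y) addrK.
Qed.

Lemma induced_action_pmap x v : d (pmap x) v = iter p (d x) v.
Proof.
have [u <-] := phi_surj v.
have iterE n : exists w,
  iter n (lie x) (i u) = i w /\ iter n (d x) (phi u) = phi w.
  elim: n => [|n [w [xw dw]]] /=; first by exists u.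
  have [w' xw'] := p_envelope_lie p_gt0 env_i x w.
  by exists w'; rewrite xw dw xw' (dP xw').
by have [w [xw ->]] := iterE p; apply: dP; rewrite lie_pmapl.
Qed.

Lemma induced_action_img u v : d (i u) (phi v) = lie (phi u) (phi v).
Proof. by rewrite -phi_lie; apply: dP; have [-> _ _] := env_i. Qed.

Lemma induced_action_eq0 x :
  d x = 0 <-> forall u, lie x (i u) \in (i @: lker phi)%VS.
Proof.
split=> [dx0 u | xk].
  have [v xu] := p_envelope_lie p_gt0 env_i x u;
    rewrite xu memv_img // memv_ker.
  by rewrite -(dP xu) dx0 zero_lfunE.
apply/lfunP => v; have [u <-] := phi_surj v; rewrite zero_lfunE.
by have /memv_imgP[w] := xk u; rewrite memv_ker => /eqP <- /dP.
Qed.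

End Actions.

(** Both images are closed under commutators and p-th powers and contain the
    inner derivations of V; the preimage in L of the image of L' is a
    [p]-subalgebra containing U, hence is L. *)
Lemma induced_action_limg (p : nat) (p_gt0 : (0 < p)%N) (F : fieldType)
    (U U' V : lieAlgType F) (L L' : resLieAlgType p F)
    (i : 'Hom(U, L)) (i' : 'Hom(U', L')) (phi : 'Hom(U, V)) (phi' : 'Hom(U', V))
    (d : 'Hom(L, 'End(V))) (d' : 'Hom(L', 'End(V))) :
  p_envelope i -> lie_morphism phi -> surjective phi ->
    induced_action i phi d ->
  p_envelope i' -> lie_morphism phi' -> surjective phi' ->
    induced_action i' phi' d' ->
  forall x, exists x', d x = d' x'.
Proof.
move=> env_i phiL phi_surj dP env_i' phiL' phi_surj' dP' x.
suff full : (d @^-1: limg d')%VS = fullv.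
  have : x \in (d @^-1: limg d')%VS by rewrite full memvf.
  by rewrite -memv_preim => /memv_imgP[x' _ ->]; exists x'.
apply: (p_envelope_ind env_i); last first.
  move=> u; rewrite -memv_preim; have [u' phi_u] := phi_surj' (phi u).
  apply/memv_imgP; exists (i' u'); first exact: memvf.
  apply/lfunP => v; have [w <-] := phi_surj v; have [w' phi_w] :=
    phi_surj' (phi w).
  by rewrite (induced_action_img env_i phiL dP) -phi_u -phi_w
    (induced_action_img env_i' phiL' dP').
split=> [y z|y]; rewrite -!memv_preim.
  move=> /memv_imgP[y' _ dy] /memv_imgP[z' _ dz].
  rewrite (induced_action_lie p_gt0 env_i phi_surj dP) dy dz.
  by rewrite -(induced_action_lie p_gt0 env_i' phi_surj' dP') memv_img ?memvf.
move=> /memv_imgP[y' _ dy]; apply/memv_imgP; exists (pmap y'); first exact: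
  memvf.
apply/lfunP => v; rewrite (induced_action_pmap p_gt0 env_i phi_surj dP) dy.
by rewrite (induced_action_pmap p_gt0 env_i' phi_surj' dP').
Qed.

(** Both L and M act on V with the same image in End V, and the action of M has
    kernel Z(M); so N = M / Z(M) is that image, on which L maps. *)
Lemma envelope_morphism (p : nat) (p_gt0 : (0 < p)%N) (F : fieldType)
    (U V : lieAlgType F) (L M N : resLieAlgType p F)
    (i : 'Hom(U, L)) (j : 'Hom(V, M)) (phi : 'Hom(U, V)) (pi : 'Hom(M, N)) :
  p_envelope i -> p_envelope j -> lie_morphism phi -> surjective phi ->
  res_morphism pi -> surjective pi ->
  (forall y, (pi y == 0) = (y \in centre M)) ->
  exists f : 'Hom(L, N), [/\ res_morphism f, surjective f
    & forall x, f x = 0 <-> forall u, lie x (i u) \in (i @: lker phi)%VS].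
Proof.
move=> env_i env_j phiL phi_surj piR pi_surj kpi.
have id_lie : lie_morphism (\1 : 'Hom(V, V))%VF by move=> x y;
  rewrite !id_lfunE.
have id_surj : surjective (\1 : 'Hom(V, V))%VF by move=> x; exists x;
  rewrite id_lfunE.
have [d dP] := induced_action_exists p_gt0 env_i phiL.
have [e eP] := induced_action_exists p_gt0 env_j id_lie.
have de := induced_action_limg p_gt0 env_i phiL phi_surj dP env_j id_lie
  id_surj eP.
have ed := induced_action_limg p_gt0 env_j id_lie id_surj eP env_i phiL
  phi_surj dP.
have e0 y : (e y == 0) = (pi y == 0).
  rewrite kpi;
    apply/eqP/idP => [/(induced_action_eq0 p_gt0 env_j id_surj eP) ye|/centreP
      ye].
    apply: (p_envelope_centre p_gt0 env_j) => v; have /memv_imgP[w] := ye v.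
    by rewrite memv_ker id_lfunE => /eqP -> ->; rewrite linear0.
  apply/(induced_action_eq0 p_gt0 env_j id_surj eP) => v.
  by rewrite ye mem0v.
pose f : 'Hom(L, N) := (pi \o (e^-1 \o d))%VF.
have fE x y : d x = e y -> f x = pi y.
  move=> dx; rewrite !comp_lfunE; apply/eqP; rewrite -subr_eq0 -linearB -e0.
  by rewrite linearB /= dx limg_lfunVK ?subrr // memv_img ?memvf.
exists f; split.
- split=> [x x'|x]; have [y dx] := de x.
    have [y' dx'] := de x'; rewrite (fE _ _ dx) (fE _ _ dx') -(piR.1).
    apply: fE; rewrite (induced_action_lie p_gt0 env_i phi_surj dP) dx dx'.
    by rewrite -(induced_action_lie p_gt0 env_j id_surj eP).
  rewrite (fE _ _ dx) -(piR.2); apply: fE; apply/lfunP => v.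
  rewrite (induced_action_pmap p_gt0 env_i phi_surj dP) dx.
  by rewrite (induced_action_pmap p_gt0 env_j id_surj eP).
- move=> z; have [y <-] := pi_surj z; have [x ey] := ed y.
  by exists x; apply: fE.
move=> x; rewrite -(induced_action_eq0 p_gt0 env_i phi_surj dP).
have [y dx] := de x; rewrite (fE _ _ dx) dx.
by split=> /eqP; [rewrite -e0|rewrite e0] => /eqP.
Qed.

(** * Primitive algebras and their envelopes *)

Definition abelian_lie (F : fieldType) (L : lieAlgType F) :=
  forall x y : L, lie x y = 0.

Lemma abelian_soluble (F : fieldType) (L : lieAlgType F) :
  abelian_lie L -> soluble L.
Proof.
move=> abL; exists 1%N; apply/eqP; rewrite -subv0.
by apply/lie_prod_subP => x y _ _; rewrite abL mem0v.
Qed.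

Section PrimitiveRestricted.
Variables (p : nat) (p_gt1 : (1 < p)%N) (F : fieldType).
Implicit Types L M N : resLieAlgType p F.

Let p_gt0 : (0 < p)%N. Proof. exact: ltnW. Qed.

(** The centre is a [p]-ideal inside the self-centralising minimal [p]-ideal A;
    if it were A, every element would centralise A, so L would be A and
    abelian. *)
Lemma p_primitive_centre L : p_primitive L -> ~ abelian_lie L ->
  centre L = 0%VS.
Proof.
move=> [A [[idA A0 minA] cA]] nabL.
have sZA : (centre L <= A)%VS.
  by apply/subvP => x /centreP xL; apply/cA => a _.
case: (minA _ (p_ideal_centre p_gt0 L) sZA) => // ZA; case: nabL => x y.
have /centreP : x \in centre L; last exact.
rewrite ZA; apply/cA => a; rewrite -ZA => /centreP aL.
by rewrite lie_antisym aL oppr0.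
Qed.

Lemma atom_abelian L : p_primitive L -> abelian_lie L -> atom L.
Proof.
move=> [A [[idA A0 minA] cA]] abL.
have AL : A = fullv by apply/vspaceP => x; rewrite memvf; apply/cA => a _.
split; [exact: abelian_soluble | by rewrite -AL | move=> U [subU pU]].
rewrite -AL; apply: minA; last by rewrite AL subvf.
by split=> // x y Uy; rewrite abL mem0v.
Qed.

(** For a in A, (ad a)^2 = 0, so (ad a)^p = 0 and the p-th power of a is
    central. *)
Lemma pmap_abelian_ideal L (A : {vspace L}) : ideal A ->
  (forall a b, a \in A -> b \in A -> lie a b = 0) -> centre L = 0%VS ->
  forall a, a \in A -> pmap a = 0.
Proof.
move=> idA abA Z0 a Aa; apply/eqP; rewrite -memv0 -Z0; apply/centreP => y.
rewrite lie_pmapl.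
have iter0 n : iter n.+2 (lie a) y = 0.
  elim: n => [|n IHn]; last by rewrite iterS IHn lie0r.
  by rewrite /= abA // ideal_liel.
by have := iter0 p.-2; rewrite -subn2 -addn2 subnK.
Qed.

(** The p-map vanishes on the minimal [p]-ideal A, so A is minimal as an ideal;
    since M does not centralise A, A = [M, A], which lies in V as [M, M] does.
    Ideals of V are ideals of M, so A is a minimal ideal of V. *)
Lemma primitive_of_p_primitive (V : lieAlgType F) M (j : 'Hom(V, M)) :
  p_envelope j -> p_primitive M -> ~ abelian_lie M -> primitive V.
Proof.
move=> env_j primM nabM; have Z0 := p_primitive_centre primM nabM.
have [j_lie j_inj _] := env_j; have j0 : lker j == 0%VS by apply/lker0P.
have [A [[[idA pA] A0 minA] cA]] := primM.
have abA a b : a \in A -> b \in A -> lie a b = 0 by move=> /cA; apply.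
have pmapA := pmap_abelian_ideal idA abA Z0.
have sMA : (lie_prod fullv A <= A)%VS.
  by apply/lie_prod_subP => x a _; apply: idA.
have sub_p_ideal (B : {vspace M}) : ideal B -> (B <= A)%VS -> p_ideal B.
  move=> idB /subvP sBA; split=> // b Bb.
  by rewrite pmapA ?mem0v ?sBA.
have MA : lie_prod fullv A = A.
  case: (minA _ (sub_p_ideal (lie_prod fullv A) _ sMA) sMA) => //.
    by move=> x y /(subvP sMA) Ay; apply: lie_prodP; rewrite ?memvf.
  move=> MA0; case: nabM => x y.
  have xA z : z \in A.
    apply/cA => a Aa; apply/eqP; rewrite -memv0 -MA0.
    by apply: lie_prodP; rewrite ?memvf.
  exact: abA.
have sAV : (A <= limg j)%VS.
  rewrite -MA; apply/lie_prod_subP => x a _ _.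
  exact: (p_envelope_derived p_gt0 env_j).
pose AV := (j @^-1: A)%VS; have jAV : (j @: AV)%VS = A by rewrite lpreimK.
exists AV; split; first split.
- exact: ideal_preim.
- by apply: contra A0 => /eqP AV0; rewrite -jAV AV0 limg0.
- move=> B idB sBAV; have sB : (j @: B <= A)%VS by rewrite -jAV limgS.
  case: (minA _ (sub_p_ideal _ (p_envelope_ideal p_gt0 env_j idB) sB) sB) => jB.
    by left; apply/eqP; rewrite -(eq_limg_ker0 _ _ j0) jB limg0.
  by right; apply/eqP; rewrite -(eq_limg_ker0 _ _ j0) jB jAV.
move=> x; rewrite -memv_preim -cA; split=> cx a Aa.
  move: Aa; rewrite -jAV => /memv_imgP[b Ab ->].
  by rewrite -j_lie cx ?linear0.
by apply: j_inj; rewrite linear0 j_lie cx // memv_preim.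
Qed.

End PrimitiveRestricted.

Section CentrelessEnvelopes.
Variables (p : nat) (p_gt1 : (1 < p)%N) (F : fieldType).
Variables (V : lieAlgType F).

Lemma ideal_derived n : ideal (derived V n).
Proof.
elim: n => [|n IHn] x y Dy; first exact: memvf.
suff : (derived V n.+1 <= linfun (lie x) @^-1: derived V n.+1)%VS.
  by move=> /subvP/(_ y Dy); rewrite -memv_preim lfunE.
apply/lie_prod_subP => u v Du Dv; rewrite -memv_preim lfunE /= lie_derivation.
by apply: memvD; apply: lie_prodP => //; apply: IHn.
Qed.

(** The operators ad b, for b in s, commute on A because A is abelian and
    contains their brackets, and each is nilpotent at every vector of A: the
    last nonzero vector in the orbit of a common null vector of the previous
    operators is a common null vector of one more. *)
Lemma common_null_vector (A : {vspace V}) (s : seq V) a0 :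
  ideal A -> (forall a b, a \in A -> b \in A -> lie a b = 0) ->
  (forall b c, b \in s -> c \in s -> lie b c \in A) ->
  (forall b a, b \in s -> a \in A -> exists n, iter n (lie b) a = 0) ->
  a0 \in A -> a0 != 0 ->
  exists a, [/\ a \in A, a != 0 & forall b, b \in s -> lie b a = 0].
Proof.
move=> idA abA; elim: s => [|b s IHs] com nil Aa0 a0_neq0.
  by exists a0; split.
have [||a [Aa a_neq0 sa0]] := IHs _ _ Aa0 a0_neq0.
- by move=> c d sc sd; apply: com; rewrite inE ?sc ?sd orbT.
- by move=> c a sc; apply: nil; rewrite inE sc orbT.
have exn : exists n, iter n (lie b) a == 0.
  by have [n /eqP ba0] := nil b a (mem_head _ _) Aa; exists n.
case: (ex_minnP exn) => -[|n]; first by rewrite /= (negPf a_neq0).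
move=> /eqP ba0 minn.
have itA m : iter m (lie b) a \in A by elim: m => // m IHm; apply: idA.
exists (iter n (lie b) a); split=> //.
  by apply/negP => /minn; rewrite ltnn.
move=> c; rewrite inE => /orP[/eqP -> //|sc].
elim: {ba0 minn} n => [|n IHn] /=; first exact: sa0.
rewrite lie_derivation IHn lie0r addr0; apply: abA => //.
by apply: com; rewrite inE ?sc ?eqxx ?orbT.
Qed.

Variables (N : resLieAlgType p F) (k : 'Hom(V, N)).
Hypotheses (env_k : p_envelope k) (primV : primitive V) (solV : soluble V).
Hypotheses (nabV : ~ abelian_lie V).
Hypothesis centreless : forall x, (forall v, lie x (k v) = 0) -> x = 0.

Let p_gt0 : (0 < p)%N. Proof. exact: ltnW. Qed.

(** Only the inclusion of the centraliser of A in A is not formal. It amounts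
    to the vanishing of the first cohomology of V / A in A, and holds because
    some e in N satisfies [e, N] <= A while ad e is injective on A. To find e,
    let D be the last term of the derived series of V outside A, so that [D, D]
    <= A: for b in D, the p-th power e of b satisfies [e, N] <= A. The kernel
    of ad e on A is an ideal of V, hence 0 or A. If it were A for every b in D,
    then D would act on A by commuting nilpotent operators, so D would
    centralise A and lie in A. Given c centralising A, [e, c] = [e, a] for some
    a in A, as ad e is bijective on A; then c - a centralises e and A, so ad e
    kills [c - a, V] <= A, and c - a centralises V, that is, c = a. *)
Lemma p_primitive_envelope : p_primitive N.
Proof.
have [k_lie k_inj _] := env_k; have k0 : lker k == 0%VS by apply/lker0P.
have [AV [[idAV AV0 minAV] cAV]] := primV.
have abAV a b : a \in AV -> b \in AV -> lie a b = 0 by move=> /cAV; apply.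
pose A := (k @: AV)%VS.
have idA : ideal A by apply: p_envelope_ideal.
have kA v : (k v \in A) = (v \in AV).
  by apply/memv_imgP/idP => [[w Aw /k_inj ->] | ] //; exists v.
have abA a b : a \in A -> b \in A -> lie a b = 0.
  move=> /memv_imgP[u Au ->] /memv_imgP[v Av ->].
  by rewrite -k_lie abAV ?linear0.
have Z0 : centre N = 0%VS.
  apply/eqP; rewrite -subv0; apply/subvP => x /centreP xN.
  by rewrite memv0; apply/eqP/centreless => v.
have pmapA := pmap_abelian_ideal p_gt1 idA abA Z0.
have [D [idD notDA DDA]] : exists D : {vspace V},
    [/\ ideal D, ~~ (D <= AV)%VS & forall b c, b \in D -> c \in D ->
      lie b c \in AV].
  have exn : exists n, (derived V n <= AV)%VS.
    by have [n Vn] := solV; exists n; rewrite Vn sub0v.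
  case: (ex_minnP exn) => -[|n] sDA minn.
    by case: nabV => x y; apply: abAV; apply: (subvP sDA); rewrite memvf.
  exists (derived V n); split; first exact: ideal_derived.
    by apply/negP => /minn; rewrite ltnn.
  by move=> b c Db Dc; apply: (subvP sDA); apply: lie_prodP.
have eA b y : b \in D -> lie (pmap (k b)) y \in A.
  move=> Db; rewrite lie_pmapl.
  have kD : lie (k b) y \in (k @: D)%VS.
    by apply: ideal_liel; [apply: p_envelope_ideal | apply: memv_img].
  have iterA n : iter n.+2 (lie (k b)) y \in A.
    elim: n => [|n IHn]; last by rewrite iterS idA.
    have /memv_imgP[c Dc bc] := kD; rewrite /= bc -k_lie kA.
    exact: DDA.
  by have := iterA p.-2; rewrite -subn2 -addn2 subnK.
have [e eN e_inj] : exists2 e, (forall y, lie e y \in A) &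
    forall a, a \in A -> lie e a = 0 -> a = 0.
  apply: NNPP => no_e.
  have pnil b a : b \in D -> a \in AV -> iter p (lie b) a = 0.
    move=> Db Aa; set e := pmap (k b).
    pose K := (AV :&: lker (linfun (lie e) \o k))%VS.
    have KE v : (v \in K) = (v \in AV) && (lie e (k v) == 0).
      by rewrite memv_cap memv_ker comp_lfunE lfunE.
    have idK : ideal K.
      move=> v c; rewrite !KE => /andP[Ac /eqP ec]; rewrite idAV //=.
      by rewrite k_lie lie_derivation ec lie0r addr0 abA ?kA ?eA.
    have kiter n : k (iter n (lie b) a) = iter n (lie (k b)) (k a).
      by elim: n => //= n <-.
    case: (minAV K idK (capvSl _ _)) => [K0|KA].
      case: no_e; exists e => [y|c]; first exact: eA.
      move=> /memv_imgP[v Av ->] ev; have : v \in K by rewrite KE Av ev eqxx.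
      by rewrite K0 memv0 => /eqP ->; rewrite linear0.
    apply: k_inj; rewrite linear0 kiter -lie_pmapl.
    by move: Aa; rewrite -KA KE => /andP[_ /eqP].
  have [a0 Aa0 a0_neq0] : exists2 a, a \in AV & a != 0.
    by exists (vpick AV); rewrite ?memv_pick ?vpick0.
  have [||a [Aa a_neq0 Da]] :=
      @common_null_vector AV (vbasis D) a0 idAV abAV _ _ Aa0 a0_neq0.
  - by move=> b c /vbasis_mem Db /vbasis_mem Dc; apply: DDA.
  - by move=> b a /vbasis_mem Db Aa; exists p; apply: pnil.
  pose K := (AV :&: transporter D 0)%VS.
  have KA : K = AV.
    case: (minAV K _ (capvSl _ _)) => // [v c|K0].
      rewrite !memv_cap => /andP[Ac Tc]; rewrite idAV //=.
      exact: (ideal_transporter idD (@ideal0 _ _)).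
    have : a \in K.
      rewrite memv_cap Aa; apply/transporterP => b /coord_vbasis ->.
      rewrite linear_sum memv_suml // => i _; rewrite linearZ /=.
      by rewrite lie_antisym Da ?mem_nth ?size_tuple // oppr0 scaler0 mem0v.
    by rewrite K0 memv0 (negPf a_neq0).
  case/negP: notDA; apply/subvP => b Db; apply/cAV => c.
  rewrite -KA memv_cap => /andP[_ /transporterP/(_ b Db)].
  by rewrite memv0 lie_antisym oppr_eq0 => /eqP.
exists A; split; first split.
- by split=> // a Aa; rewrite pmapA ?mem0v.
- by rewrite -(limg0 k) eq_limg_ker0.
- move=> B [idB _] sBA.
  have kB : (k @: (k @^-1: B))%VS = B.
    by rewrite lpreimK // (subv_trans sBA) // limgS ?subvf.
  case: (minAV (k @^-1: B)%VS).
  + exact: ideal_preim.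
  + by rewrite -(limg_ker0 _ _ k0) kB.
  + by move=> B0; left; rewrite -kB B0 limg0.
  by move=> BA; right; rewrite -kB BA.
move=> c; split=> [cA|Ac a Aa]; last exact: abA.
have eAA : (linfun (lie e) @: A)%VS = A.
  apply/eqP; rewrite eqEdim; apply/andP; split.
    by apply/subvP => _ /memv_imgP[a Aa ->]; rewrite lfunE; apply: eN.
  rewrite limg_dim_eq //; apply/eqP; rewrite -subv0; apply/subvP => a.
  rewrite memv_cap memv_ker lfunE /= memv0 => /andP[Aa /eqP ea].
  by apply/eqP; apply: e_inj.
have : lie e c \in (linfun (lie e) @: A)%VS by rewrite eAA.
move=> /memv_imgP[a Aa]; rewrite lfunE /= => ec.
have ec' : lie e (c - a) = 0 by rewrite linearB /= ec subrr.
have cA' b : b \in A -> lie (c - a) b = 0.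
  by move=> Ab; rewrite lieDl lieNl cA // abA // subrr.
suff -> : c = a by [].
apply/eqP; rewrite -subr_eq0; apply/eqP/centreless => v.
apply: e_inj; last first.
  by rewrite lie_derivation ec' lie0l add0r cA'.
have /memv_imgP[w _ cw] := p_envelope_derived p_gt0 env_k (c - a) (k v).
rewrite cw kA; apply/cAV => b Ab; apply: k_inj; rewrite linear0 k_lie -cw.
have -> : lie (lie (c - a) (k v)) (k b) =
    lie (c - a) (lie (k v) (k b)) - lie (k v) (lie (c - a) (k b)).
  by rewrite (lie_derivation (c - a)) addrK.
by rewrite !cA' ?idA ?kA // lie0r subrr.
Qed.

End CentrelessEnvelopes.

(** * Schunck classes and p-envelopes *)

Section SchunckClasses.
Variables (p : nat) (F : fieldType) (p_gt1 : (1 < p)%N).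
Implicit Types (K : res_lie_class p F) (L M N : resLieAlgType p F).

Let p_gt0 : (0 < p)%N. Proof. exact: ltnW. Qed.

Lemma p_schunck_img K L M (f : 'Hom(L, M)) : p_schunck K ->
  res_morphism f -> surjective f -> K L -> K M.
Proof.
move=> [isoK _ solK clK] fR f_surj KL; apply/clK.
apply/(p_primitive_closureP M p_gt0 isoK); split.
  by apply: soluble_img (proj1 fR) f_surj _; apply: solK.
move=> N g gR g_surj primN.
have /clK/(p_primitive_closureP L p_gt0 isoK)[_] := KL.
apply; last exact: primN.
  exact: res_morphism_comp fR gR.
exact: surjective_comp.
Qed.

(** The abelian p-primitive algebras are atoms, hence belong to K. *)
Lemma pSch_nonabelian K L : pSch K -> soluble L ->
  (forall M (f : 'Hom(L, M)), res_morphism f -> surjective f ->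
    p_primitive M -> ~ abelian_lie M -> K M) -> K L.
Proof.
move=> [[isoK _ _ clK] atomK] solL KL; apply/clK.
apply/(p_primitive_closureP L p_gt0 isoK); split=> // M f fR f_surj primM.
have [abM|nabM] := classic (abelian_lie M); last exact: KL fR f_surj primM nabM.
exact/atomK/atom_abelian.
Qed.

(** A non-abelian p-primitive quotient of L has centre 0, so it factors through
    any quotient of L by central elements. *)
Lemma pSch_central_extension K L M (f : 'Hom(L, M)) : pSch K -> soluble L ->
  res_morphism f -> surjective f -> (forall x, f x = 0 -> x \in centre L) ->
  K M -> K L.
Proof.
move=> pSK solL fR f_surj kf KM; apply:
  (pSch_nonabelian pSK solL) => N g gR g_surj primN nabN.
have Z0 := p_primitive_centre p_gt1 primN nabN.
have [|h hE] := factor_surjection (g := g) f_surj.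
  move=> x /kf /centreP xL; apply/eqP; rewrite -memv0 -Z0; apply/centreP => y.
  by have [y' <-] := g_surj y; rewrite -(proj1 gR) xL linear0.
apply: (p_schunck_img (proj1 pSK) _ _ KM (f := h)).
  exact: res_morphism_factor f_surj fR gR hE.
by move=> z; have [x <-] := g_surj z; exists (f x).
Qed.

(** L maps onto M / Z(M), of which M is a central extension. *)
Lemma pSch_envelope K (U V : lieAlgType F) L M
    (i : 'Hom(U, L)) (j : 'Hom(V, M)) (phi : 'Hom(U, V)) :
  pSch K -> p_envelope i -> p_envelope j -> lie_morphism phi ->
    surjective phi ->
  K L -> K M.
Proof.
move=> pSK env_i env_j phiL phi_surj KL.
have solM : soluble M.
  apply: (p_envelope_soluble p_gt0 env_j); apply: soluble_img phiL phi_surj _.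
  have [i_lie i_inj _] := env_i; apply: soluble_sub i_lie i_inj _.
  by have [[_ _ solK _] _] := pSK; apply: solK.
have [N [pi [piR pi_surj piE]]] := central_quotient p_gt0 M.
have [f [fR f_surj _]] :=
  envelope_morphism p_gt0 env_i env_j phiL phi_surj piR pi_surj piE.
apply: (pSch_central_extension pSK solM piR pi_surj).
  by move=> x /eqP; rewrite piE.
exact: p_schunck_img (proj1 pSK) fR f_surj KL.
Qed.

Lemma id_lie_morphism (U : lieAlgType F) : lie_morphism (\1 : 'Hom(U, U))%VF.
Proof. by move=> x y; rewrite !id_lfunE. Qed.

Lemma id_surjective (U : lieAlgType F) : surjective (\1 : 'Hom(U, U))%VF.
Proof. by move=> x; exists x; rewrite id_lfunE. Qed.

Lemma Envd_envelope K (U : lieAlgType F) L (i : 'Hom(U, L)) :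
  pSch K -> p_envelope i -> Envd K U -> K L.
Proof.
move=> pSK env_i [M [j [KM env_j]]].
exact: pSch_envelope pSK env_j env_i (@id_lie_morphism U) (@id_surjective U) KM.
Qed.

Lemma p_envelope_iso (U V : lieAlgType F) L (i : 'Hom(U, L)) (g : 'Hom(V, U)) :
  lie_morphism g -> bijective g -> p_envelope i -> p_envelope (i \o g)%VF.
Proof.
move=> gL g_bij env_i; have [i_lie i_inj gen] := env_i; split.
- exact: lie_morphism_comp.
- by move=> x y; rewrite !comp_lfunE => /i_inj; apply: bij_inj.
by move=> W pW; rewrite limg_comp (surjective_limg (bij_surjective g_bij));
  apply: gen.
Qed.

Lemma iso_closed_Envd K : iso_closed (Envd K).
Proof.
move=> U V /lie_iso_sym[g [gL g_bij]] [L [i [KL env_i]]].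
by exists L, (i \o g)%VF; split=> //; apply: p_envelope_iso.
Qed.

(** V is the image of U in M. *)
Lemma p_envelope_quotient (U : lieAlgType F) L M (i : 'Hom(U, L)) (f : 'Hom(L,
  M)) :
  p_envelope i -> res_morphism f -> surjective f ->
  exists (V : lieAlgType F) (phi : 'Hom(U, V)) (j : 'Hom(V, M)),
    [/\ lie_morphism phi, surjective phi & p_envelope j].
Proof.
move=> env_i fR f_surj; have [i_lie i_inj _] := env_i.
have fiL : lie_morphism (f \o i)%VF by apply: lie_morphism_comp (proj1 fR).
have [phi [phiL phi_surj phiE]] := quot_projP (ideal_lker fiL).
have [|j jE] := factor_surjection (g := (f \o i)%VF) phi_surj.
  by move=> u /eqP; rewrite phiE memv_ker => /eqP.
exists _, phi, j; split=> //; split.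
- exact: lie_morphism_factor phi_surj phiL fiL jE.
- apply/lker0P; rewrite -subv0; apply/subvP => v; have [u <-] := phi_surj v.
  by rewrite memv_ker jE memv0 phiE memv_ker.
move=> W pW sW; have W' : (f @^-1: W)%VS = fullv.
  apply: (p_envelope_ind env_i); first exact: p_subalgebra_preim.
  move=> u; rewrite -memv_preim -[f _]comp_lfunE -jE; apply: (subvP sW).
  by rewrite memv_img ?memvf.
apply/vspaceP => y; rewrite memvf; have [x <-] := f_surj y.
by rewrite memv_preim W' memvf.
Qed.

Lemma Envd_soluble K (U : lieAlgType F) : pSch K -> Envd K U -> soluble U.
Proof.
move=> [[_ _ solK _] _] [L [i [KL [i_lie i_inj _]]]].
by apply: soluble_sub i_lie i_inj _; apply: solK.
Qed.

End SchunckClasses.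

(** * The operator Envd *)

Section EnvdOperator.
Variables (p : nat) (F : fieldType) (pcharFp : p \in [pchar F]).
Implicit Types (K : res_lie_class p F) (L M N : resLieAlgType p F).
Implicit Types (U V : lieAlgType F).

Let p_gt1 : (1 < p)%N. Proof. exact: prime_gt1 (pcharf_prime pcharFp). Qed.
Let p_gt0 : (0 < p)%N. Proof. exact: ltnW. Qed.

Lemma Envd_img K U V (phi : 'Hom(U, V)) : pSch K ->
  lie_morphism phi -> surjective phi -> Envd K U -> Envd K V.
Proof.
move=> pSK phiL phi_surj EU; have solU := Envd_soluble pSK EU.
have [L [i [KL env_i]]] := EU.
have [M [j env_j]] :=
  p_envelope_exists pcharFp (soluble_img phiL phi_surj solU).
exists M, j; split=> //.
exact (pSch_envelope p_gt1 pSK env_i env_j phiL phi_surj KL).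
Qed.

Lemma Envd_abelian K V : pSch K -> abelian_lie V -> Envd K V.
Proof.
move=> pSK abV; have solV := abelian_soluble abV.
have [M [j env_j]] := p_envelope_exists pcharFp solV.
exists M, j; split=> //.
have abM : abelian_lie M.
  have [j_lie _ _] := env_j.
  move=> x; apply/centreP; apply: (p_envelope_centre p_gt0 env_j) => v.
  apply/eqP; rewrite -memv0.
  apply: (p_envelope_transporter p_gt0 env_j (sub0v (limg j))); last first.
    by rewrite memv_img ?memvf.
  by move=> u _ /memv_imgP[w _ ->]; rewrite -j_lie abV linear0 mem0v.
apply: (pSch_nonabelian p_gt1 pSK (abelian_soluble abM)) => N f [fL _] f_surj
  _ [].
by move=> y z; have [y' <-] := f_surj y; have [z' <-] := f_surj z;
  rewrite -fL abM linear0.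
Qed.

Lemma primitive_centreless V : primitive V -> ~ abelian_lie V ->
  forall v : V, (forall w, lie v w = 0) -> v = 0.
Proof.
move=> [A [[idA A0 minA] cA]] nabV v vV; apply/eqP; rewrite -memv0.
have sZA : (centre V <= A)%VS.
  by apply/subvP => x /centreP xV; apply/cA => a _.
case: (minA _ (@ideal_centre _ V) sZA) => [<-|ZA]; first exact/centreP.
case: nabV => x y; have /centreP : x \in centre V; last exact.
rewrite ZA; apply/cA => a; rewrite -ZA => /centreP aV.
by rewrite lie_antisym aV oppr0.
Qed.

(** N is M / Z(M) for an envelope M of V: it contains V because V has centre 0,
    and its own centre is 0 because an element of M acting on V with values in
    Z(M) acts with values in the centre of V. *)
Lemma primitive_quotient_envelope U V L (i : 'Hom(U, L)) (phi : 'Hom(U, V)) :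
  p_envelope i -> lie_morphism phi -> surjective phi ->
  soluble V -> primitive V -> ~ abelian_lie V ->
  exists N (f : 'Hom(L, N)) (k : 'Hom(V, N)),
    [/\ res_morphism f, surjective f, p_envelope k & p_primitive N].
Proof.
move=> env_i phiL phi_surj solV primV nabV.
have ZV := primitive_centreless primV nabV.
have [M [j env_j]] := p_envelope_exists pcharFp solV.
have [j_lie j_inj _] := env_j.
have [N [pi [piR pi_surj piE]]] := central_quotient p_gt0 M.
have [f [fR f_surj _]] :=
  envelope_morphism p_gt0 env_i env_j phiL phi_surj piR pi_surj piE.
have ZjV v : j v \in centre M -> v = 0.
  move=> /centreP jvZ; apply: ZV => w; apply: j_inj.
  by rewrite j_lie jvZ linear0.
pose k := (pi \o j)%VF; have kE v : k v = pi (j v) by rewrite comp_lfunE.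
have k_lie : lie_morphism k := lie_morphism_comp j_lie (proj1 piR).
have env_k : p_envelope k.
  split=> [//||W pW sW].
    apply/lker0P; rewrite -subv0; apply/subvP => v.
    by rewrite memv_ker kE piE => /ZjV ->; rewrite mem0v.
  have W' : (pi @^-1: W)%VS = fullv.
    apply: (p_envelope_ind env_j); first exact: p_subalgebra_preim.
    by move=> v; rewrite -memv_preim -kE (subvP sW) ?memv_img ?memvf.
  apply/vspaceP => y; rewrite memvf; have [x <-] := pi_surj y.
  by rewrite memv_preim W' memvf.
have centreless x : (forall v, lie x (k v) = 0) -> x = 0.
  have [y <-] := pi_surj x; move=> yk; apply/eqP; rewrite piE.
  apply: (p_envelope_centre p_gt0 env_j) => v.
  have [w yw] := p_envelope_lie p_gt0 env_j y v; rewrite yw.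
  have /eqP := yk v; rewrite kE -(proj1 piR) yw piE => /ZjV ->.
  exact: linear0.
exists N, f, k; split=> //.
exact (p_primitive_envelope p_gt1 env_k primV solV nabV centreless).
Qed.

Lemma primitive_quotient_of_envelope U L M (i : 'Hom(U, L)) (f : 'Hom(L, M)) :
  p_envelope i -> res_morphism f -> surjective f ->
  p_primitive M -> ~ abelian_lie M ->
  exists V (phi : 'Hom(U, V)) (j : 'Hom(V, M)),
    [/\ lie_morphism phi, surjective phi, p_envelope j & primitive V].
Proof.
move=> env_i fR f_surj primM nabM.
have [V [phi [j [phiL phi_surj env_j]]]] := p_envelope_quotient env_i fR f_surj.
exists V, phi, j; split=> //.
exact (primitive_of_p_primitive p_gt1 env_j primM nabM).
Qed.

(** The 1 by 1 matrices: a one-dimensional algebra has no proper nonzero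
    subspace. *)
Lemma res_gl_atom : atom (res_gl 0 pcharFp).
Proof.
have dim1 : \dim {: res_gl 0 pcharFp} = 1%N by rewrite dimvf dim_matrix.
split.
- apply: abelian_soluble => x y; rewrite gl_lieE.
  apply/eqP; rewrite subr_eq0 [x]mx11_scalar; apply/eqP.
  exact: (esym (scalar_mxC _ _)).
- by rewrite -dimv_eq0 dim1.
move=> U _; have [/eqP|U0] := boolP (U == 0%VS); first by left.
by right; apply/eqP; rewrite eqEdim subvf dim1 lt0n dimv_eq0.
Qed.

Lemma Sch_Envd K : pSch K -> Sch (Envd K).
Proof.
move=> pSK; have [[isoK _ solK clK] atomK] := pSK.
have [U EU U0] : exists2 U, Envd K U & {:U}%VS != 0%VS.
  have atomG := res_gl_atom; exists (res_gl 0 pcharFp); last by case: atomG.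
  exists (res_gl 0 pcharFp), \1%VF; split; first exact: atomK.
  split=> [||W _]; first exact: id_lie_morphism.
    by move=> x y; rewrite !id_lfunE.
  by rewrite lim1g => sW; apply/eqP; rewrite eqEsubv sW subvf.
split; last by exists U.
have isoE := @iso_closed_Envd p F K.
split=> //; [by exists U | by move=> V; apply: Envd_soluble | move=> V].
split=> [/(primitive_closureP V isoE)[solV EV] | EV].
  have [L [i env_i]] := p_envelope_exists pcharFp solV.
  exists L, i; split=> //.
  apply: (pSch_nonabelian p_gt1 pSK (p_envelope_soluble p_gt0 env_i solV)).
  move=> M f fR f_surj primM nabM.
  have [W [phi [j [phiL phi_surj env_j primW]]]] :=
    primitive_quotient_of_envelope env_i fR f_surj primM nabM.
  exact (Envd_envelope p_gt1 pSK env_j (EV _ _ phiL phi_surj primW)).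
apply/(primitive_closureP V isoE); split; first exact: Envd_soluble EV.
by move=> W phi phiL phi_surj _; apply: Envd_img phi_surj EV.
Qed.

Lemma Envd_meet K1 K2 U : pSch K1 -> pSch K2 ->
  Envd (pSch_meet K1 K2) U <-> Sch_meet (Envd K1) (Envd K2) U.
Proof.
move=> pS1 pS2; split=> [[L [i [[KL1 KL2] env_i]]] | [[L [i [KL1 env_i]]] E2]].
  by split; exists L, i.
by exists L, i; split=> //; split=> //;
  exact (Envd_envelope p_gt1 pS2 env_i E2).
Qed.

Lemma Envd_join K1 K2 U : pSch K1 -> pSch K2 ->
  Envd (pSch_join K1 K2) U <-> Sch_join (Envd K1) (Envd K2) U.
Proof.
move=> pS1 pS2.
have isoS : iso_closed (fun V => Skel (Envd K1) V \/ Skel (Envd K2) V).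
  move=> V W isoVW [] [EV primV]; [left | right].
    split; [exact: iso_closed_Envd isoVW EV | exact: primitive_iso isoVW primV].
  split; [exact: iso_closed_Envd isoVW EV | exact: primitive_iso isoVW primV].
have isoP : p_iso_closed (fun L => p_Skel K1 L \/ p_Skel K2 L).
  have [[iso1 _ _ _] _] := pS1; have [[iso2 _ _ _] _] := pS2.
  move=> L M isoLM [] [KL primL]; [left | right].
    split; [exact: iso1 isoLM KL | exact: p_primitive_iso isoLM primL].
  split; [exact: iso2 isoLM KL | exact: p_primitive_iso isoLM primL].
split.
  move=> [L [i [/(p_primitive_closureP L p_gt0 isoP)[solL JL] env_i]]].
  have [i_lie i_inj _] := env_i; have solU := soluble_sub i_lie i_inj solL.
  apply/(primitive_closureP U isoS); split=> // V phi phiL phi_surj primV.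
  have [abV|nabV] := classic (abelian_lie V).
    by left; split=> //; apply: Envd_abelian.
  have solV := soluble_img phiL phi_surj solU.
  have [N [f [k [fR f_surj env_k primN]]]] :=
    primitive_quotient_envelope env_i phiL phi_surj solV primV nabV.
  by case: (JL N f fR f_surj primN) => -[KN _]; [left|right]; split=> //;
    exists N, k.
move=> /(primitive_closureP U isoS)[solU JU].
have [L [i env_i]] := p_envelope_exists pcharFp solU.
exists L, i; split=> //; apply/(p_primitive_closureP L p_gt0 isoP).
split=> [|M f fR f_surj primM]; first exact: p_envelope_soluble env_i solU.
have [abM|nabM] := classic (abelian_lie M).
  by left; split=> //; apply: (proj2 pS1); apply: atom_abelian.
have [V [phi [j [phiL phi_surj env_j primV]]]] :=
  primitive_quotient_of_envelope env_i fR f_surj primM nabM.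
by case: (JU V phi phiL phi_surj primV) => -[EV _]; [left|right]; split=> //;
  apply: Envd_envelope env_j EV.
Qed.

(** The last term D of the derived series of U is perfect, so its image in each
    soluble quotient is 0. *)
Lemma soluble_residual U (I : Type) (J : I -> {vspace U}) (idJ : forall i,
  ideal (J i)) :
  (forall x, (forall i, x \in J i) -> x = 0) ->
  (forall i, soluble (quot (idJ i))) -> soluble U.
Proof.
move=> J0 solJ.
have [D [n Dn] minD] := @minimal_vspace _ _ (fun W => exists n, W = derived U n)
  fullv (ex_intro _ 0%N erefl).
have DD : lie_prod D D = D.
  apply: minD; first by exists n.+1; rewrite Dn.
  by apply/lie_prod_subP => x y _; rewrite Dn; apply: ideal_derived.
exists n; rewrite -Dn; apply/eqP; rewrite -subv0; apply/subvP => x Dx.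
rewrite memv0; apply/eqP/J0 => i.
have [f [fL f_surj fE]] := quot_projP (idJ i).
have [m solm] := solJ i; rewrite -fE -memv0 -solm.
suff : (D <= f @^-1: derived (quot (idJ i)) m)%VS.
  by move=> /subvP/(_ x Dx); rewrite -memv_preim.
elim: {solm} m => [|m IHm].
  by apply/subvP => y _; rewrite -memv_preim memvf.
rewrite -DD; apply/lie_prod_subP => y z Dy Dz; rewrite -memv_preim fL.
by apply: lie_prodP; rewrite memv_preim (subvP IHm).
Qed.

(** L / Z(L) is residually in K through the images of the [p]-ideals C a = {x |
    [x, U] <= J a}: their intersection is Z(L), and L / C a is a quotient of a
    p-envelope of U / J a. *)
Lemma formation_Envd K : pSch K -> p_formation K -> formation (Envd K).
Proof.
move=> pSK [isoK _ solK _ resK].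
have [[isoE [U EU] solE _] _] := Sch_Envd pSK.
split=> //; first by exists U.
  move=> V J idJ EV; have [f [fL f_surj _]] := quot_projP idJ.
  exact: Envd_img f_surj EV.
move=> {U EU} U I J idJ J0 EJ.
have solU : soluble U by apply: (soluble_residual J0) => i; apply/solE/EJ.
have [L [i env_i]] := p_envelope_exists pcharFp solU.
have [i_lie i_inj _] := env_i.
exists L, i; split=> //.
have solL := p_envelope_soluble p_gt0 env_i solU.
have [N [pi [piR pi_surj piE]]] := central_quotient p_gt0 L.
apply: (pSch_central_extension p_gt1 pSK solL piR pi_surj).
  by move=> x /eqP; rewrite piE.
pose C a := transporter (limg i) (i @: J a)%VS.
have pidC a : p_ideal (C a).
  split; last by apply: p_closed_transporter => //; apply: limgS; apply: subvf.
  apply: ideal_transporter; apply: (p_envelope_ideal p_gt0 env_i) => //.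
  exact: ideal_fullv.
have sZC a : (centre L <= C a)%VS.
  by apply/subvP => x /centreP xL; apply/transporterP => y _; rewrite xL mem0v.
have pidK a : p_ideal (pi @: C a)%VS by apply: p_ideal_img.
have piC a x : (pi x \in (pi @: C a)%VS) = (x \in C a).
  apply/idP/idP => [/memv_imgP[y Cy /eqP] | Cx]; last exact: memv_img.
  rewrite -subr_eq0 -linearB piE => /(subvP (sZC a)) Cxy.
  by rewrite -[x](subrK y) memvD.
apply: (resK _ I _ pidK) => [y|a].
  have [x <-] := pi_surj y; move=> xC; apply/eqP; rewrite piE.
  apply: (p_envelope_centre p_gt0 env_i) => u.
  have [v xu] := p_envelope_lie p_gt0 env_i x u; rewrite xu.
  suff -> : v = 0 by rewrite linear0.
  apply: J0 => a; have := xC a; rewrite piC => /transporterP/(_ (i u)).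
  by rewrite memv_img ?memvf // xu => /(_ isT)/memv_imgP[w Jw /i_inj ->].
have [phi [phiL phi_surj phiE]] := quot_projP (idJ a).
have kphi : lker phi = J a by apply/vspaceP => x; rewrite memv_ker phiE.
have [M [j [KM env_j]]] := EJ a.
have [P [q [qR q_surj qE]]] := central_quotient p_gt0 M.
have [f [fR f_surj f0]] :=
  envelope_morphism p_gt0 env_i env_j phiL phi_surj qR q_surj qE.
have [g [gR g_surj gE]] := p_quot_projP (pidK a).
have gpiR := res_morphism_comp piR gR.
have [|h hE] := factor_surjection (g := (g \o pi)%VF) f_surj.
  move=> x /f0; rewrite kphi => xC; rewrite comp_lfunE; apply/eqP.
  by rewrite gE piC; apply/transporterP => _ /memv_imgP[u _ ->].
apply: (p_schunck_img p_gt1 (proj1 pSK) (f := h)).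
- exact: res_morphism_factor f_surj fR gpiR hE.
- move=> z; have [y <-] := g_surj z; have [x <-] := pi_surj y.
  by exists (f x); rewrite hE comp_lfunE.
exact: p_schunck_img (proj1 pSK) qR q_surj KM.
Qed.

End EnvdOperator.

Theorem theorem9p9 (F : fieldType) (p : nat) (pcharFp : p \in [pchar F]%R) :
  [/\ forall K : res_lie_class p F, pSch K -> Sch (Envd K),
      forall K1 K2 : res_lie_class p F, pSch K1 -> pSch K2 ->
        forall U : lieAlgType F,
          Envd (pSch_meet K1 K2) U <-> Sch_meet (Envd K1) (Envd K2) U,
      forall K1 K2 : res_lie_class p F, pSch K1 -> pSch K2 ->
        forall U : lieAlgType F,
          Envd (pSch_join K1 K2) U <-> Sch_join (Envd K1) (Envd K2) U
    & forall K : res_lie_class p F, pSch K ->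
        p_formation K -> formation (Envd K)].
Proof.
split; [exact: Sch_Envd pcharFp | | | exact: formation_Envd pcharFp].
  by move=> K1 K2 pS1 pS2 U; apply: Envd_meet pS1 pS2.
by move=> K1 K2 pS1 pS2 U; apply: Envd_join pS1 pS2.
Qed.
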